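(* Every homogeneous quartic generalised projective special real (GPSR) manifold (of any dimension $n\ge1$) is singular at infinity.
   Context: Let $h:\mathbb{R}^{n+1}\to\mathbb{R}$, $n\ge1$, be a homogeneous polynomial. A point $p$ is a hyperbolic point of $h$ if $-\partial^2h_p$ (minus the Hessian bilinear form of $h$ at $p$) has Lorentzian signature (exactly one negative and $n$ positive eigenvalues). $h$ is hyperbolic if it has a hyperbolic point. A quartic GPSR manifold of dimension $n$ is a hypersurface $\mathcal{H}\subset\mathbb{R}^{n+1}$ contained in $\{h=1\}$ for a hyperbolic homogeneous polynomial $h$ of degree $4$ and consisting only of hyperbolic points of $h$. It carries the Riemannian metric $g_{\mathcal{H}}=-\frac14\partial^2h|_{T\mathcal{H}\times T\mathcal{H}}$. It is homogeneous if the group of all $A\in\mathrm{GL}(n+1)$ with $A(\mathcal{H})=\mathcal{H}$ acts transitively on $\mathcal{H}$. $\mathcal{H}\subset\{h=1\}$ is singular at infinity if there is a point $p\in\partial(\mathbb{R}_{>0}\cdot\mathcal{H})\setminus\{0\}$ (boundary in $\mathbb{R}^{n+1}$ of the cone spanned by $\mathcal{H}$) with $h(p)=0$ and $dh_p=0$. *)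

(* Defs.v *)
From HB Require Import structures.
From mathcomp Require Import all_boot all_order all_algebra.
From mathcomp Require Import all_classical all_reals all_analysis.
From mathcomp Require mpoly.
(* mpoly's notations clash with those of MathComp-Analysis *)
Import -(notations) mpoly.

Set Implicit Arguments.
Unset Strict Implicit.
Unset Printing Implicit Defensive.

Import Order.TTheory GRing.Theory Num.Theory.
Import numFieldNormedType.Exports.

Local Open Scope classical_set_scope.
Local Open Scope ring_scope.

(* R^(n+1) is 'rV[R]_n.+1; a polynomial h on it is an element of
   mpoly n.+1 R, and matrices act on row vectors from the right. *)

Section Polynomials.
Context {R : realType} {n : nat}.
Implicit Types (h : mpoly n.+1 R) (p : 'rV[R]_n.+1).

Definition poly_at h p : R := meval (fun i => p 0 i) h.

Definition gradient_at h p : 'rV[R]_n.+1 :=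
  \row_i poly_at (mderiv i h) p.

Definition hessian_at h p : 'M[R]_n.+1 :=
  \matrix_(i, j) poly_at (mderiv i (mderiv j h)) p.

(* s lists the eigenvalues of M with their multiplicities *)
Definition lorentzian (M : 'M[R]_n.+1) : Prop :=
  exists s : seq R,
    [/\ char_poly M = \prod_(a <- s) ('X - a%:P),
        count (fun a => a < 0) s = 1%N
      & count (fun a => 0 < a) s = n].

Definition hyperbolic_point h p : Prop := lorentzian (- hessian_at h p).

Definition hyperbolic h : Prop := exists p, hyperbolic_point h p.

End Polynomials.

Section Hypersurfaces.
Context {R : realType} {n : nat}.
Implicit Types (U H C : set 'rV[R]_n.+1) (f : 'rV[R]_n.+1 -> R).

(* f is of class C^k on the open set U; the values of f outside U are
   irrelevant *)
Fixpoint class_C (k : nat) U f : Prop :=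
  if k is k'.+1 then
    (forall x, U x -> differentiable f x) /\
    (forall v, class_C k' U (fun x => 'd f x v))
  else forall x, U x -> {for x, continuous f}.

Definition smooth_on U f : Prop := forall k, class_C k U f.

(* nonempty embedded smooth submanifold of codimension 1, given by local
   regular equations *)
Definition hypersurface H : Prop :=
  H !=set0 /\
  forall p, H p -> exists U f,
    [/\ open U /\ U p, smooth_on U f,
        forall x, U x -> exists v, 'd f x v != 0
      & H `&` U = [set x | U x /\ f x = 0]].

Definition boundary C : set 'rV[R]_n.+1 := closure C `\` interior C.

Definition cone_over H : set 'rV[R]_n.+1 :=
  [set x | exists t y, [/\ 0 < t, H y & x = t *: y]].

Definition linear_symmetry H (A : 'M[R]_n.+1) : Prop :=
  A \in unitmx /\ [set x *m A | x in H] = H.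

Definition homogeneous_hypersurface H : Prop :=
  forall x y, H x -> H y -> exists2 A, linear_symmetry H A & x *m A = y.

Definition quartic_GPSR (h : mpoly n.+1 R) H : Prop :=
  [/\ h \is ishomog1 4 mdeg, hyperbolic h, hypersurface H,
      (forall x, H x -> poly_at h x = 1)
    & (forall x, H x -> hyperbolic_point h x)].

Definition singular_at_infinity (h : mpoly n.+1 R) H : Prop :=
  exists p, [/\ boundary (cone_over H) p, p != 0,
                poly_at h p = 0 & gradient_at h p = 0].

End Hypersurfaces.

(* Main.v *)
(* Let C be the cone over H, and x0 a point of H.  By Euler's relation H is
   relatively open in {h = 1}, so C is open, and every symmetry of H preserves h.
   Homogeneity gives uniform balls around the points of H in the metric attached
   to h, so that h = 0 on the boundary of C.  The Lorentzian signature makes h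
   quasi-concave on segments of C; hence the part S of C visible from x0 is
   pointed, and it is both open and closed in {h > 0}.
   Take a quadratic cone around the axis x0 that contains S and touches its
   closure along a ray through p.  If dh_p <> 0, this contact makes the Hessian
   of h at p negative definite on ker dh_p modulo p.  Dilate by p -> p,
   w -> e^2 w, x0 -> e^4 x0, where w is in ker dh_p, and pull back by a
   symmetry sending x0 to a multiple of p + e^4 x0.  The resulting linear maps
   N_e stay bounded, and a cluster point N as e -> 0 satisfies, up to a constant,
   h (N (a p + b x0 + w)) = a^3 b dh_p(x0) + a^2 d^2h_p(w, w) / 2.
   The right-hand side is nondegenerate, so N is invertible, and it is singular
   at x0; hence h is singular at N x0, a limit of points of C. *)

Require Import Defs.
From mathcomp Require Import all_boot all_order all_algebra.
From mathcomp Require Import all_classical all_reals all_analysis.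
From mathcomp Require mpoly complex.
Import -(notations) mpoly.
From mathcomp Require Import ring lra.

Set Implicit Arguments.
Unset Strict Implicit.
Unset Printing Implicit Defensive.

Import Order.TTheory GRing.Theory Num.Theory.
Import numFieldNormedType.Exports.

Local Open Scope classical_set_scope.
Local Open Scope ring_scope.

(** * Directional derivatives and the Euler relation *)

Section DirectionalDerivative.
Context {R : realType} {n : nat}.
Implicit Types (q : mpoly n.+1 R) (x u v : 'rV[R]_n.+1).

Definition dirder v q : mpoly n.+1 R := \sum_i v 0 i *: mderiv i q.

Lemma dirderD v q r : dirder v (q + r) = dirder v q + dirder v r.
Proof. by rewrite -big_split; apply: eq_bigr => i _; rewrite mderivD scalerDr. Qed.

Lemma dirderZ v c q : dirder v (c *: q) = c *: dirder v q.
Proof.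
rewrite scaler_sumr; apply: eq_bigr => i _.
by rewrite mderivZ !scalerA mulrC.
Qed.

Lemma dirder_sum v (I : Type) (s : seq I) (F : I -> mpoly n.+1 R) :
  dirder v (\sum_(i <- s) F i) = \sum_(i <- s) dirder v (F i).
Proof.
elim: s => [|i s IH]; last by rewrite !big_cons dirderD IH.
by rewrite !big_nil /dirder big1 // => i _; rewrite mderiv0 scaler0.
Qed.

Lemma dirderDl u v q : dirder (u + v) q = dirder u q + dirder v q.
Proof. by rewrite -big_split; apply: eq_bigr => i _; rewrite mxE scalerDl. Qed.

Lemma dirderZl c v q : dirder (c *: v) q = c *: dirder v q.
Proof. by rewrite scaler_sumr; apply: eq_bigr => i _; rewrite mxE scalerA. Qed.

Lemma dirder_dirder u v q :
  dirder u (dirder v q) = \sum_i \sum_j (u 0 i * v 0 j) *: mderiv i (mderiv j q).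
Proof.
apply: eq_bigr => i _; rewrite /dirder (raddf_sum (mderiv i)) scaler_sumr.
by apply: eq_bigr => j _ /=; rewrite mderivZ scalerA.
Qed.

Lemma dirderC u v q : dirder u (dirder v q) = dirder v (dirder u q).
Proof.
rewrite !dirder_dirder exchange_big; apply: eq_bigr => i _; apply: eq_bigr => j _.
by rewrite mderiv_comm mulrC.
Qed.

Lemma dirder_homog v q d :
  q \is ishomog1 d.+1 mdeg -> dirder v q \is ishomog1 d mdeg.
Proof.
move=> /dhomogP hq; rewrite rpred_sum // => i _; apply/rpredZ/dhomogP => m.
rewrite mcoeff_msupp mcoeff_mderiv => nz.
have /hq : mnm_add m (mnm1 i) \in msupp q.
  by rewrite mcoeff_msupp; apply: contraNneq nz => ->; rewrite mul0rn.
by rewrite /= mdegD mdeg1 addn1 => -[].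
Qed.

Lemma homog0_at q x y : q \is ishomog1 0 mdeg -> poly_at q x = poly_at q y.
Proof.
move=> /dhomogP hq; suff -> : q = mpolyC n.+1 (mcoeff mnm0 q) by rewrite /poly_at !mevalC.
apply/mpolyP => m; rewrite mcoeffC.
have [<-|nm0] := eqVneq; first by rewrite mulr1.
rewrite mulr0; apply/eqP; apply: contraNT nm0 => /=.
by rewrite -mcoeff_msupp => /hq /eqP; rewrite mdeg_eq0 eq_sym.
Qed.

Lemma euler_monomial (m : multinom n.+1) x :
  poly_at (dirder x (mpolyX R m)) x = (mdeg m)%:R * poly_at (mpolyX R m) x.
Proof.
rewrite /poly_at /dirder raddf_sum mdegE natr_sum mulr_suml.
apply: eq_bigr => i _ /=; rewrite mevalZ mderivX mevalZ mulrCA.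
have [->|mi] := eqVneq (m i) 0; first by rewrite !mul0r.
congr (_ * _); have <- : mnm_add (mnm_sub m (mnm1 i)) (mnm1 i) = m.
  by rewrite submK // lep1mP.
by rewrite mpolyXD mevalM mevalXU mulrC addmK.
Qed.

Lemma euler_homog q x d : q \is ishomog1 d mdeg ->
  poly_at (dirder x q) x = d%:R * poly_at q x.
Proof.
move=> /dhomogP hq; rewrite [q in LHS]mpolyE dirder_sum [q in RHS]mpolyE /poly_at.
rewrite !raddf_sum mulr_sumr !big_seq; apply: eq_bigr => m /hq /= dm.
rewrite dirderZ !mevalZ.
by have := euler_monomial m x; rewrite /poly_at => ->; rewrite dm mulrCA.
Qed.

Lemma poly_at_dirder q x v : poly_at (dirder v q) x = \sum_i v 0 i * poly_at (mderiv i q) x.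
Proof. by rewrite /poly_at raddf_sum; apply: eq_bigr => i _ /=; rewrite mevalZ. Qed.

End DirectionalDerivative.

(** * Symmetric quartic forms *)

Record quartic_form (R : realType) (n : nat) := QuarticForm {
  qf :> 'rV[R]_n -> 'rV[R]_n -> 'rV[R]_n -> 'rV[R]_n -> R;
  qf_swap12 : forall a b c d, qf a b c d = qf b a c d;
  qf_swap23 : forall a b c d, qf a b c d = qf a c b d;
  qf_swap34 : forall a b c d, qf a b c d = qf a b d c;
  qf_linear : forall a b c k d e, qf a b c (k *: d + e) = k * qf a b c d + qf a b c e }.

Section QuarticForm.
Context {R : realType} {n : nat} (T : quartic_form R n).
Implicit Types (a b c d e p u v w x y : 'rV[R]_n) (k s t : R).

Lemma qfD4 a b c d e : T a b c (d + e) = T a b c d + T a b c e.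
Proof. by rewrite -[d]scale1r qf_linear mul1r scale1r. Qed.

Lemma qfD3 a b c d e : T a b (d + e) c = T a b d c + T a b e c.
Proof. by rewrite qf_swap34 qfD4 !(qf_swap34 _ _ _ c). Qed.

Lemma qfD2 a b c d e : T a (d + e) b c = T a d b c + T a e b c.
Proof. by rewrite qf_swap23 qfD3 !(qf_swap23 _ _ b). Qed.

Lemma qfD1 a b c d e : T (d + e) a b c = T d a b c + T e a b c.
Proof. by rewrite qf_swap12 qfD2 !(qf_swap12 _ a). Qed.

Lemma qf04 a b c : T a b c 0 = 0.
Proof.
have := qfD4 a b c 0 0; rewrite addr0 => /eqP.
by rewrite -subr_eq0 opprD addNKr oppr_eq0 => /eqP.
Qed.

Lemma qfZ4 a b c k d : T a b c (k *: d) = k * T a b c d.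
Proof. by rewrite -[k *: d]addr0 qf_linear qf04 addr0. Qed.

Lemma qfN4 a b c d : T a b c (- d) = - T a b c d.
Proof. by rewrite -scaleN1r qfZ4 mulN1r. Qed.

Lemma qfZ3 a b c k d : T a b (k *: d) c = k * T a b d c.
Proof. by rewrite qf_swap34 qfZ4 qf_swap34. Qed.

Lemma qfZ2 a b c k d : T a (k *: d) b c = k * T a d b c.
Proof. by rewrite qf_swap23 qfZ3 qf_swap23. Qed.

Lemma qfZ1 a b c k d : T (k *: d) a b c = k * T d a b c.
Proof. by rewrite qf_swap12 qfZ2 qf_swap12. Qed.

Definition qfD := (qfD1, qfD2, qfD3, qfD4).
Definition qfZ := (qfZ1, qfZ2, qfZ3, qfZ4).

Lemma qf_along x v t : T (x + t *: v) (x + t *: v) (x + t *: v) (x + t *: v) =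
  T x x x x + 4 * t * T x x x v + 6 * t ^+ 2 * T x x v v + 4 * t ^+ 3 * T x v v v
  + t ^+ 4 * T v v v v.
Proof.
rewrite !(qfD, qfZ) !(qf_swap12 T v x, qf_swap23 T _ v x, qf_swap34 T _ _ v x).
by ring.
Qed.

Lemma qf_scale k x : T (k *: x) (k *: x) (k *: x) (k *: x) = k ^+ 4 * T x x x x.
Proof. by rewrite !qfZ; ring. Qed.

Lemma qf_sum4 a b c (I : Type) (r : seq I) (F : I -> 'rV[R]_n) :
  T a b c (\sum_(i <- r) F i) = \sum_(i <- r) T a b c (F i).
Proof.
elim: r => [|i r IH]; first by rewrite !big_nil qf04.
by rewrite !big_cons qfD IH.
Qed.

Lemma qf_coord4 a b c d : T a b c d = \sum_i d 0 i * T a b c (delta_mx 0 i).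
Proof.
by rewrite {1}[d]row_sum_delta qf_sum4; apply: eq_bigr => i _; rewrite qfZ.
Qed.

Lemma qf_cvg (X : Type) (F : set_system X) (FF : Filter F)
    (f1 f2 f3 f4 : X -> 'rV[R]_n) a b c d :
  f1 @ F --> a -> f2 @ F --> b -> f3 @ F --> c -> f4 @ F --> d ->
  (fun z => T (f1 z) (f2 z) (f3 z) (f4 z)) @ F --> T a b c d.
Proof.
have cvg4 x y z f l : f @ F --> l -> (fun i => T x y z (f i)) @ F --> T x y z l.
  move=> fl; rewrite qf_coord4; under eq_fun do rewrite qf_coord4.
  apply: (@cvg_big R _ +%R 0 xpredT (@add_continuous R)) => i _; apply: cvgM; last exact: cvg_cst.
  exact: (continuous_cvg _ (@coord_continuous _ _ _ _ _ _)).
have cvg3 x y f g l m : f @ F --> l -> g @ F --> m ->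
    (fun i => T x y (f i) (g i)) @ F --> T x y l m.
  move=> fl gm; rewrite qf_coord4; under eq_fun do rewrite qf_coord4.
  apply: (@cvg_big R _ +%R 0 xpredT (@add_continuous R)) => i _; apply: cvgM.
    exact: (continuous_cvg _ (@coord_continuous _ _ _ _ _ _)).
  by under eq_fun do rewrite qf_swap34; rewrite qf_swap34; apply: cvg4.
have cvg2 x f g h l m y : f @ F --> l -> g @ F --> m -> h @ F --> y ->
    (fun i => T x (f i) (g i) (h i)) @ F --> T x l m y.
  move=> fl gm hy; rewrite qf_coord4; under eq_fun do rewrite qf_coord4.
  apply: (@cvg_big R _ +%R 0 xpredT (@add_continuous R)) => i _; apply: cvgM.
    exact: (continuous_cvg _ (@coord_continuous _ _ _ _ _ _)).
  under eq_fun do rewrite qf_swap34 qf_swap23.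
  by rewrite qf_swap34 qf_swap23; apply: cvg3.
move=> f1a f2b f3c f4d; rewrite qf_coord4; under eq_fun do rewrite qf_coord4.
apply: (@cvg_big R _ +%R 0 xpredT (@add_continuous R)) => i _; apply: cvgM.
  exact: (continuous_cvg _ (@coord_continuous _ _ _ _ _ _)).
under eq_fun do rewrite qf_swap34 qf_swap23 qf_swap12.
by rewrite qf_swap34 qf_swap23 qf_swap12; apply: cvg2.
Qed.

End QuarticForm.

Arguments qf_cvg {R n} T {X F FF f1 f2 f3 f4 a b c d}.

Section Polarization.
Context {R : realType} {n : nat} (h : mpoly n.+1 R).
Implicit Types (u v x : 'rV[R]_n.+1).

Definition polar a b c d : R :=
  poly_at (dirder a (dirder b (dirder c (dirder d h)))) 0 / 24.

Fact polar_swap12 a b c d : polar a b c d = polar b a c d.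
Proof. by rewrite /polar dirderC. Qed.

Fact polar_swap23 a b c d : polar a b c d = polar a c b d.
Proof. by rewrite /polar (dirderC b). Qed.

Fact polar_swap34 a b c d : polar a b c d = polar a b d c.
Proof. by rewrite /polar (dirderC c). Qed.

Fact polar_linear a b c k d e :
  polar a b c (k *: d + e) = k * polar a b c d + polar a b c e.
Proof.
rewrite /polar dirderDl dirderZl !(dirderD, dirderZ) /poly_at mevalD mevalZ.
by rewrite mulrDl mulrA.
Qed.

Definition polar_form : quartic_form R n.+1 :=
  QuarticForm polar_swap12 polar_swap23 polar_swap34 polar_linear.

Hypothesis h4 : h \is ishomog1 4 mdeg.

Lemma polar_hess x u v :
  12 * polar x x u v = \sum_i \sum_j u 0 i * v 0 j * hessian_at h x i j.
Proof.
have h2 : dirder u (dirder v h) \is ishomog1 2 mdeg by do 2 apply: dirder_homog.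
have h1 : dirder x (dirder u (dirder v h)) \is ishomog1 1 mdeg by apply: dirder_homog.
have h0 := dirder_homog x h1.
have e0 := homog0_at x 0 h0.
have := euler_homog x h2; have := euler_homog x h1; rewrite mul1r => e1 e2.
have -> : \sum_i \sum_j u 0 i * v 0 j * hessian_at h x i j =
    poly_at (dirder u (dirder v h)) x.
  rewrite dirder_dirder /poly_at raddf_sum; apply: eq_bigr => i _ /=.
  by rewrite raddf_sum; apply: eq_bigr => j _ /=; rewrite mevalZ mxE.
by rewrite /polar -e0 e1 e2; field.
Qed.

Lemma polar_grad x v : 4 * polar x x x v = \sum_i v 0 i * gradient_at h x 0 i.
Proof.
have h3 : dirder v h \is ishomog1 3 mdeg by apply: dirder_homog.
have h2 := dirder_homog x h3; have h1 := dirder_homog x h2.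
have h0 := dirder_homog x h1.
have e0 := homog0_at x 0 h0.
have := euler_homog x h3; have := euler_homog x h2; have := euler_homog x h1.
rewrite mul1r => e1 e2 e3.
have -> : \sum_i v 0 i * gradient_at h x 0 i = poly_at (dirder v h) x.
  by rewrite poly_at_dirder; apply: eq_bigr => i _ /=; rewrite mxE.
by rewrite /polar -e0 e1 e2 e3; field.
Qed.

Lemma polar_diag x : polar x x x x = poly_at h x.
Proof.
apply: (@mulfI _ 4); first by [].
rewrite polar_grad -(euler_homog x h4) poly_at_dirder.
by apply: eq_bigr => i _; rewrite mxE.
Qed.

End Polarization.

(** * Lorentzian matrices *)

Section Lorentzian.
Import complex.
Local Open Scope sesquilinear_scope.

Lemma char_poly_conj (F : fieldType) n (P A : 'M[F]_n) : P \in unitmx ->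
  char_poly (invmx P *m A *m P) = char_poly A.
Proof.
move=> Pu; have PPu : map_mx polyC P \in unitmx.
  by rewrite map_unitmx.
rewrite /char_poly /char_poly_mx.
have -> : 'X%:M - map_mx polyC (invmx P *m A *m P) =
    map_mx polyC (invmx P) *m ('X%:M - map_mx polyC A) *m map_mx polyC P.
  rewrite !map_mxM mulmxBr mulmxBl; congr (_ - _).
  by rewrite mul_mx_scalar -scalemxAl -map_mxM mulVmx // map_mx1 scalemx1.
rewrite !det_mulmx mulrAC -det_mulmx -map_mxM mulVmx // map_mx1 det1 mul1r //.
Qed.

Lemma hermitian_pos_orthogonal (C : numClosedFieldType) n (A : 'M[C]_n.+1)
    (s : seq C) (x v : 'rV[C]_n.+1) :
  A \is hermsymmx -> char_poly A = \prod_(a <- s) ('X - a%:P) ->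
  count (fun a => 0 < a) s = n ->
  (x *m A *m x ^t*) 0 0 < 0 -> (x *m A *m v ^t*) 0 0 = 0 ->
  v != 0 -> ~~ ((v *m A *m v ^t*) 0 0 <= 0).
Proof.
move=> Aherm chA cs.
have /orthomx_spectralP := hermitian_normalmx Aherm.
set P := spectralmx A; set d := spectral_diag A => Adef.
have PU : P \is unitarymx by exact: spectral_unitarymx.
have Pu : P \in unitmx by exact: unitarymx_unit.
pose y (z : 'rV[C]_n.+1) := z *m invmx P.
have form (z w : 'rV[C]_n.+1) : (z *m A *m w ^t*) 0 0 = \sum_i d 0 i * (y z 0 i * (y w 0 i)^*).
  have -> : z *m A *m w ^t* = y z *m diag_mx d *m (y w) ^t*.
    have -> : w ^t* = P ^t* *m (y w) ^t*.
      by rewrite -map_mxM -trmx_mul mulmxKV.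
    rewrite Adef !mulmxA -(mulmxA _ P) (unitarymxP PU) mulmx1.
    by [].
  rewrite mxE; apply: eq_bigr => i _.
  by rewrite mul_mx_diag !mxE; ring.
have [i0 dpos] : exists i0, forall i, i != i0 -> 0 < d 0 i.
  have : perm_eq s [seq d 0 i | i <- enum 'I_n.+1].
    apply: prod_XsubC_eq; rewrite -chA Adef char_poly_conj // char_poly_trig.
      by rewrite big_map big_enum; apply: eq_bigr => i _; rewrite mxE eqxx.
    by apply/is_trig_mxP => i j ij; rewrite mxE -val_eqE /= ltn_eqF.
  move=> /permP/(_ (fun a => 0 < a)); rewrite cs count_map => cn.
  have : #|[pred i | ~~ (0 < d 0 i)]| = 1%N.
    have := cardC [pred i | 0 < d 0 i]; rewrite card_ord.
    have -> : #|[pred i | 0 < d 0 i]| = n.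
      by rewrite [RHS]cn -sum1_count big_enum_cond -sum1_card; apply: eq_bigl.
    by move=> e; apply: (@addnI n); rewrite [LHS]e addn1.
  move=> /mem_card1[i0 i0P]; exists i0 => i ii0.
  by have := i0P i; rewrite !inE (negPf ii0) => /negbFE.
have dge0 i c : i != i0 -> 0 <= d 0 i * (c * c^*).
  by move=> ii0; rewrite mulr_ge0 ?mul_conjC_ge0 // ltW // dpos.
move=> xneg xv vn0; apply/negP => vle.
have pos z : y z 0 i0 = 0 -> 0 <= (z *m A *m z ^t*) 0 0.
  move=> z0; rewrite form sumr_ge0 // => i _.
  by have [->|ii0] := eqVneq i i0; rewrite ?z0 ?mul0r ?mulr0 ?dge0.
have [v0|v0] := eqVneq (y v 0 i0) 0.
  have : (v *m A *m v ^t*) 0 0 == 0 by rewrite eq_le vle pos.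
  rewrite form psumr_eq0; last first.
    by move=> i _; have [->|ii0] := eqVneq i i0; rewrite ?v0 ?mul0r ?mulr0 ?dge0.
  move=> /allP all0; case/eqP: vn0.
  have yv : y v = 0.
    apply/rowP => i; rewrite [RHS]mxE; have [->|ii0] := eqVneq i i0; first exact: v0.
    have := all0 i (mem_index_enum i); rewrite /= mulf_eq0 gt_eqF ?dpos //=.
    by rewrite mul_conjC_eq0 => /eqP.
  by rewrite -(mulmxKV Pu v) -/(y v) yv mul0mx.
have vx : (v *m A *m x ^t*) 0 0 = 0.
  apply/eqP; rewrite -conjC_eq0 -xv !form rmorph_sum; apply/eqP.
  apply: eq_bigr => i _ /=; rewrite !rmorphM /= conjCK.
  by rewrite (CrealP (mxOverP (hermitian_spectral_diag_real Aherm) 0 i)); ring.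
pose z := y v 0 i0 *: x - y x 0 i0 *: v.
have yz i : y z 0 i = y v 0 i0 * y x 0 i - y x 0 i0 * y v 0 i.
  by rewrite {1}/y mulmxBl -!scalemxAl !mxE.
have : 0 <= (z *m A *m z ^t*) 0 0 by rewrite pos // yz mulrC subrr.
have -> : (z *m A *m z ^t*) 0 0 =
    y v 0 i0 * (y v 0 i0)^* * (x *m A *m x ^t*) 0 0 +
    y x 0 i0 * (y x 0 i0)^* * (v *m A *m v ^t*) 0 0 -
    y v 0 i0 * (y x 0 i0)^* * (x *m A *m v ^t*) 0 0 -
    y x 0 i0 * (y v 0 i0)^* * (v *m A *m x ^t*) 0 0.
  rewrite !form !mulr_sumr -big_split -!sumrB; apply: eq_bigr => i _.
  by rewrite /= yz rmorphB !rmorphM /=; ring.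
rewrite xv vx !mulr0 !subr0; apply/negP; rewrite lt_geF // -[ltRHS]addr0 ltr_leD //.
  by rewrite pmulr_rlt0 // mul_conjC_gt0.
by rewrite mulr_ge0_le0 // mul_conjC_ge0.
Qed.

Lemma lorentzian_pos_orthogonal (R : realType) n (M : 'M[R]_n.+1) (x v : 'rV[R]_n.+1) :
  M^T = M -> lorentzian M -> (x *m M *m x^T) 0 0 < 0 -> (x *m M *m v^T) 0 0 = 0 ->
  v != 0 -> 0 < (v *m M *m v^T) 0 0.
Proof.
move=> Msym [s [chM _ cs]] xneg xv vn0; pose f := real_complex R.
have fconj m p (B : 'M[R]_(m, p)) : (map_mx f B) ^t* = map_mx f B^T.
  by apply/matrixP => i j; rewrite !mxE; exact: conjc_real.
have formf z w : ((map_mx f z : 'rV_n.+1) *m map_mx f M *m (map_mx f w) ^t*) 0 0 =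
    f ((z *m M *m w^T) 0 0).
  by rewrite fconj -!map_mxM mxE.
suff : ~~ (f ((v *m M *m v^T) 0 0) <= 0) by rewrite -[X in _ <= X]/(f 0) lecR ltNge.
rewrite -formf.
apply: (@hermitian_pos_orthogonal _ _ _ (map f s) (map_mx f x)).
- apply/is_hermitianmxP; rewrite expr0 scale1r.
  by have := fconj _ _ M; rewrite Msym.
- by rewrite -map_char_poly chM map_prod_XsubC big_map.
- by rewrite count_map -[RHS]cs; apply: eq_count => a /=; rewrite -ltcR.
- by rewrite formf -[X in _ < X]/(f 0) ltcR.
- by rewrite formf xv.
- by rewrite map_mx_eq0.
Qed.

End Lorentzian.

(** * Sign of polynomials near a point *)

Section Germs.
Context {R : realType}.
Implicit Types (phi : R -> R) (a b c d s t : R).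

Lemma germ_gt0 phi (l : R) : phi @ (0 : R) --> l -> 0 < l ->
  exists2 d, 0 < d & forall s, `|s| < d -> 0 < phi s.
Proof.
move=> phil l0; have near_pos : \forall s \near (0 : R), 0 < phi s by exact: (cvgr_gt l phil 0 l0).
have /nbhs_ballP[d d0 dP] := near_pos.
by exists d => // s sd; apply: dP; rewrite /ball /= sub0r normrN.
Qed.

Lemma germ_ge0 phi (l d : R) : phi @ (0 : R) --> l -> 0 < d ->
  (forall s, 0 < s < d -> 0 <= phi s) -> 0 <= l.
Proof.
move=> phil d0 phi0; rewrite leNgt; apply/negP => l0.
have near_neg : \forall s \near (0 : R), phi s < 0 by exact: (cvgr_lt l phil 0 l0).
have /nbhs_ballP[e e0 eP] := near_neg.
pose s := Num.min d e / 2.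
have s0 : 0 < s by rewrite divr_gt0 // lt_min d0 e0.
have [sd se] : s < d /\ s < e.
  have : s < Num.min d e by rewrite /s; move: s0; rewrite /s; lra.
  by rewrite lt_min => /andP[].
have /eP : ball 0 e s by rewrite /ball /= sub0r normrN gtr0_norm.
by rewrite /= ltNge phi0 // s0.
Qed.

Lemma cubic_cvg a b c d :
  (fun s => a + b * s + c * s ^+ 2 + d * s ^+ 3) @ (0 : R) --> a.
Proof.
have pE : horner (a%:P + b *: 'X + c *: 'X^2 + d *: 'X^3) =
    fun s => a + b * s + c * s ^+ 2 + d * s ^+ 3.
  by apply/funext => s; rewrite !hornerE.
have := @continuous_horner R (a%:P + b *: 'X + c *: 'X^2 + d *: 'X^3) 0.
by rewrite /continuous_at pE !expr0n !mulr0 !addr0.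
Qed.

Lemma quartic_coef (a0 a1 a2 a3 a4 b0 b1 b2 b3 b4 : R) :
  (forall t, `|t| <= 2 -> a0 + a1 * t + a2 * t ^+ 2 + a3 * t ^+ 3 + a4 * t ^+ 4 =
             b0 + b1 * t + b2 * t ^+ 2 + b3 * t ^+ 3 + b4 * t ^+ 4) ->
  [/\ a0 = b0, a1 = b1, a2 = b2, a3 = b3 & a4 = b4].
Proof.
move=> e; have [] : [/\ `|0 : R| <= 2, `|1 : R| <= 2, `|-1 : R| <= 2, `|2 : R| <= 2 & `|-2 : R| <= 2].
  by split; rewrite ler_norml; apply/andP; split; lra.
by move=> /e e0 /e e1 /e e2 /e e3 /e e4; split; lra.
Qed.

End Germs.

Section QuarticFormGerms.
Context {R : realType} {n : nat} (T : quartic_form R n).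
Implicit Types (a b c d e p u v w x y z : 'rV[R]_n) (k s t : R).

Lemma cvg_along (X : Type) (F : set_system X) (FF : Filter F) (f : X -> R) x v s :
  f @ F --> s -> (fun i => x + f i *: v) @ F --> x + s *: v.
Proof.
by move=> fs; apply: (cvgD (cvg_cst _)); apply: (cvgZ fs); apply: cvg_cst.
Qed.

Lemma cvg_affine (X : Type) (F : set_system X) (FF : Filter F)
    (f : X -> 'rV[R]_n) u y t :
  f @ F --> y -> (fun i => u + t *: f i) @ F --> u + t *: y.
Proof.
by move=> fy; apply: (cvgD (cvg_cst _)); apply: cvgZ fy; apply: cvg_cst.
Qed.

Lemma qf_cont : continuous (fun x => T x x x x).
Proof. by move=> x; apply: (@qf_cvg _ _ T _ (nbhs x)); apply: cvg_id. Qed.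

Lemma qf_min1 x v t : 0 < t ->
  (forall s, 0 < s < t -> T x x x x <= T (x + s *: v) (x + s *: v) (x + s *: v) (x + s *: v)) ->
  0 <= T x x x v.
Proof.
move=> t0 hmin; rewrite -(pmulr_rge0 _ (ltr0n R 4)).
apply: (germ_ge0 (cubic_cvg (6 * T x x v v) (4 * T x v v v) (T v v v v)) t0).
move=> s /[dup] sd /andP[s0 _]; rewrite -(pmulr_rge0 _ s0).
by have := hmin s sd; rewrite qf_along -subr_ge0; congr (0 <= _); ring.
Qed.

Lemma qf_min2 x v t : 0 < t ->
  (forall s, 0 < s < t -> T x x x x <= T (x + s *: v) (x + s *: v) (x + s *: v) (x + s *: v)) ->
  T x x x v = 0 -> 0 <= T x x v v.
Proof.
move=> t0 hmin T1; rewrite -(pmulr_rge0 _ (ltr0n R 6)).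
apply: (germ_ge0 (cubic_cvg (4 * T x v v v) (T v v v v) 0) t0).
move=> s /[dup] sd /andP[s0 _]; rewrite -(pmulr_rge0 _ (exprn_gt0 2 s0)).
by have := hmin s sd; rewrite qf_along T1 -subr_ge0; congr (0 <= _); ring.
Qed.

Lemma qf_argmin x v t : 0 <= t -> exists2 s, 0 <= s <= t &
  forall r, 0 <= r <= t -> T (x + s *: v) (x + s *: v) (x + s *: v) (x + s *: v) <=
    T (x + r *: v) (x + r *: v) (x + r *: v) (x + r *: v).
Proof.
move=> t0.
have [|s st sP] := @EVT_min R
  (fun r => T (x + r *: v) (x + r *: v) (x + r *: v) (x + r *: v)) 0 t t0.
  apply: continuous_subspaceT => r.
  by apply: (@qf_cvg _ _ T _ (nbhs r)); apply: cvg_along; apply: cvg_id.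
exists s; first by rewrite in_itv in st.
by move=> r rt; apply: sP; rewrite in_itv.
Qed.

Lemma qf_increasing x v t : 0 < t ->
  (forall r, 0 <= r <= t -> 0 < T (x + r *: v) (x + r *: v) (x + r *: v) v) ->
  T x x x x < T (x + t *: v) (x + t *: v) (x + t *: v) (x + t *: v).
Proof.
move=> t0 pos; rewrite ltNge; apply/negP => le_tx.
suff [s st smin] : exists2 s, 0 < s <= t & forall r, 0 <= r <= t ->
    T (x + s *: v) (x + s *: v) (x + s *: v) (x + s *: v) <=
    T (x + r *: v) (x + r *: v) (x + r *: v) (x + r *: v).
  have /andP[s0 s_le] := st.
  have : 0 <= T (x + s *: v) (x + s *: v) (x + s *: v) (- v).
    apply: (@qf_min1 _ _ s) => // r /andP[r0 rs].
    by rewrite -addrA scalerN -scalerBl; apply: smin; apply/andP; split; lra.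
  rewrite -scaleN1r qfZ mulN1r oppr_ge0 leNgt pos //.
  by apply/andP; split; lra.
have [s /andP[s0 st] smin] := qf_argmin x v (ltW t0).
have [s_gt0|s_le0] := ltP 0 s; first by exists s; rewrite ?s_gt0.
have s_0 : s = 0 by apply/eqP; rewrite eq_le s_le0.
exists t => [|r rt]; first by rewrite t0 lexx.
by have := smin r rt; rewrite s_0 scale0r addr0; apply: le_trans.
Qed.

Lemma qf_invariant (L : 'rV[R]_n -> 'rV[R]_n) :
  (forall x v t, L (x + t *: v) = L x + t *: L v) ->
  (forall x, T (L x) (L x) (L x) (L x) = T x x x x) ->
  forall x v, T (L x) (L x) (L x) (L v) = T x x x v /\
              T (L x) (L x) (L v) (L v) = T x x v v.
Proof.
move=> Llin Linv x v.
have := @quartic_coef R (T (L x) (L x) (L x) (L x)) (4 * T (L x) (L x) (L x) (L v))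
  (6 * T (L x) (L x) (L v) (L v)) (4 * T (L x) (L v) (L v) (L v)) (T (L v) (L v) (L v) (L v))
  (T x x x x) (4 * T x x x v) (6 * T x x v v) (4 * T x v v v) (T v v v v).
case=> [t _|_ e1 e2 _ _]; last by split; lra.
by have := Linv (x + t *: v); rewrite Llin !qf_along => e; move: e; lra.
Qed.

Lemma qf_invariant_near (C : set 'rV[R]_n) (A : 'M[R]_n) x0 : nbhs x0 C ->
  (forall x, C x -> T (x *m A) (x *m A) (x *m A) (x *m A) = T x x x x) ->
  forall z, T (z *m A) (z *m A) (z *m A) (z *m A) = T z z z z.
Proof.
move=> Cx0 hC z.
have lim : (fun t : R => x0 + t *: z) @ (0 : R) --> x0 + 0 *: z.
  by apply: (@cvg_along _ (nbhs (0 : R))); apply: cvg_id.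
have near_C : \forall t \near (0 : R), C (x0 + t *: z).
  by apply: lim; rewrite scale0r addr0.
have /nbhs_ballP[d d0 dP] := near_C.
pose k := d / 3; have k0 : 0 < k by rewrite divr_gt0.
suff : T ((k *: z) *m A) ((k *: z) *m A) ((k *: z) *m A) ((k *: z) *m A) =
    T (k *: z) (k *: z) (k *: z) (k *: z).
  by rewrite -scalemxAl !qf_scale => /mulfI; apply; rewrite expf_neq0 // gt_eqF.
pose u := k *: z; rewrite -/u.
have [t t2|_ _ _ _ //] := @quartic_coef R
  (T (x0 *m A) (x0 *m A) (x0 *m A) (x0 *m A)) (4 * T (x0 *m A) (x0 *m A) (x0 *m A) (u *m A))
  (6 * T (x0 *m A) (x0 *m A) (u *m A) (u *m A)) (4 * T (x0 *m A) (u *m A) (u *m A) (u *m A))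
  (T (u *m A) (u *m A) (u *m A) (u *m A))
  (T x0 x0 x0 x0) (4 * T x0 x0 x0 u) (6 * T x0 x0 u u) (4 * T x0 u u u) (T u u u u).
have Ct : C (x0 + t *: u).
  rewrite scalerA; apply: dP; rewrite /ball /= sub0r normrN normrM (gtr0_norm k0).
  have kd : 2 * k < d by rewrite /k mulrA ltr_pdivrMr // [ltRHS]mulrC ltr_pM2r // ltr_nat.
  exact: le_lt_trans (ler_wpM2r (ltW k0) t2) kd.
by have := hC _ Ct; rewrite mulmxDl -scalemxAl !qf_along => e; move: e; lra.
Qed.

End QuarticFormGerms.

Section RowVectors.
Context {R : realType}.

Lemma mulmx_row_fun m k (f : 'rV[R]_m -> 'rV[R]_k) :
  (forall x t v, f (x + t *: v) = f x + t *: f v) ->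
  forall v, v *m (\matrix_i f (delta_mx 0 i)) = f v.
Proof.
move=> fL v; have f0 : f 0 = 0.
  by have := fL 0 (-1) 0; rewrite scaler0 addr0 scaleN1r subrr.
rewrite mulmx_sum_row [in RHS](row_sum_delta v).
under eq_bigr do rewrite rowK.
elim: (index_enum _) => [|i r IH]; first by rewrite !big_nil f0.
by rewrite !big_cons [in RHS]addrC fL IH addrC.
Qed.

Lemma mulmx_vec_cvg m k (v : 'rV[R]_m) (X : Type) (F : set_system X) (FF : Filter F)
    (f : X -> 'rV[R]_(m * k)) r :
  f @ F --> r -> (fun i => v *m vec_mx (f i)) @ F --> v *m vec_mx r.
Proof.
move=> fr; have sumE (u : 'rV[R]_(m * k)) :
    v *m vec_mx u = \sum_i u 0 i *: (v *m vec_mx (delta_mx 0 i)).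
  rewrite [u in LHS]row_sum_delta linear_sum /= mulmx_sumr; apply: eq_bigr => i _.
  by rewrite linearZ /= scalemxAr.
rewrite sumE; under eq_fun do rewrite sumE.
apply: (@cvg_big _ _ +%R 0 xpredT (@add_continuous 'rV[R]_k)) => i _.
apply: cvgZ; last exact: cvg_cst.
exact: (continuous_cvg _ (@coord_continuous _ _ _ _ _ _)).
Qed.

Lemma rV_norm_le m (r : 'rV[R]_m) B : 0 <= B -> (forall i, `|r 0 i| <= B) -> `|r| <= B.
Proof.
move=> B0 rB; rewrite [leLHS]/Num.norm /= mx_normrE; apply/bigmax_leP; split=> //.
by case=> i j _ /=; rewrite ord1.
Qed.

Lemma rV_coord_le m (r : 'rV[R]_m) i : `|r 0 i| <= `|r|.
Proof.
rewrite [leRHS]/Num.norm /= mx_normrE; apply/bigmax_geP; right.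
by exists (0, i).
Qed.

Lemma cluster_cvg_eq (X : topologicalType) (F : set_system X) (FF : Filter F)
    (g : X -> R) x (l : R) :
  cluster F x -> {for x, continuous g} -> g @ F --> l -> g x = l.
Proof.
move=> Fx gx gl; apply/eqP; rewrite -subr_eq0 -normr_eq0; apply/eqP.
apply/eqP; rewrite eq_le normr_ge0 andbT leNgt; apply/negP => d0.
have d20 : 0 < `|g x - l| / 2 by rewrite divr_gt0.
have Fl : F [set y | `|l - g y| < `|g x - l| / 2] by exact: (@cvgr_dist_lt _ R _ F FF g l gl _ d20).
have nx : nbhs x [set y | `|g x - g y| < `|g x - l| / 2].
  exact: (@cvgr_dist_lt _ R _ (nbhs x) _ g (g x) gx _ d20).
have [y [/= y1 y2]] := Fx _ _ Fl nx.
have := ler_normB (g x - g y) (l - g y).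
have -> : g x - g y - (l - g y) = g x - l by ring.
by lra.
Qed.

End RowVectors.

(** * Cones with a transitive group of symmetries *)

Section HomogeneousCone.
Context {R : realType} {n : nat} (T : quartic_form R n.+1) (C : set 'rV[R]_n.+1).
Implicit Types (p u v w x y z : 'rV[R]_n.+1) (k s t : R).
Local Notation h x := (T x x x x).

Hypothesis Copen : open C.
Hypothesis Ccone : forall t x, 0 < t -> C x -> C (t *: x).
Hypothesis Cpos : forall x, C x -> 0 < h x.
Hypothesis Clor : forall x v, C x -> T x x x v = 0 -> v != 0 -> T x x v v < 0.
Hypothesis Chom : forall x y, C x -> C y -> h x = h y -> exists A,
  [/\ A \in unitmx, x *m A = y, forall z, C (z *m A) <-> C z & forall z, h (z *m A) = h z].

Definition disc x v := T x x x v ^+ 2 - h x * T x x v v.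

Lemma disc_shift x v k : disc x (v + k *: x) = disc x v.
Proof. by rewrite /disc !(qfD, qfZ) (qf_swap34 T _ _ x v); ring. Qed.

Lemma disc_gt0 x v : C x -> T x x x v = 0 -> v != 0 -> 0 < disc x v.
Proof.
move=> Cx xv v0; rewrite /disc xv expr0n sub0r -mulrN mulr_gt0 ?Cpos //.
by rewrite oppr_gt0 Clor.
Qed.

Lemma polar_proj x v : C x -> T x x x (v - (T x x x v / h x) *: x) = 0.
Proof.
move=> /Cpos hx; rewrite -scaleN1r !(qfD, qfZ) mulN1r divfK ?subrr //.
by rewrite gt_eqF.
Qed.

Lemma disc_proj x v k : disc x (v - k *: x) = disc x v.
Proof. by rewrite -scaleNr disc_shift. Qed.

Lemma disc_ge0 x v : C x -> 0 <= disc x v.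
Proof.
move=> Cx; rewrite -(disc_proj x v (T x x x v / h x)).
have [->|w0] := eqVneq (v - (T x x x v / h x) *: x) 0.
  by rewrite /disc !qf04 mulr0 subr0 expr0n.
by rewrite ltW // disc_gt0 // polar_proj.
Qed.

Lemma disc_eq0 x v : C x -> disc x v = 0 -> v = (T x x x v / h x) *: x.
Proof.
move=> Cx; rewrite -(disc_proj x v (T x x x v / h x)) => d0.
apply/eqP; rewrite -subr_eq0; apply/negP => /negP w0.
by have := disc_gt0 Cx (polar_proj v Cx) w0; rewrite d0 ltxx.
Qed.

Definition gram x v := disc x v + T x x x v ^+ 2.

Lemma gram_gt0 x v : C x -> v != 0 -> 0 < gram x v.
Proof.
move=> Cx v0; rewrite /gram; have := disc_ge0 v Cx; rewrite le_eqVlt => /orP[|d0].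
  rewrite eq_sym => /eqP d0; rewrite d0 add0r exprn_even_gt0 //=.
  by apply: contraNneq v0 => t0; rewrite (disc_eq0 Cx d0) t0 mul0r scale0r.
by rewrite ltr_wpDr // sqr_ge0.
Qed.

Lemma gramZ x v k : gram (k *: x) (k *: v) = k ^+ 8 * gram x v.
Proof. by rewrite /gram /disc !qfZ; ring. Qed.

Lemma gramZr x v k : gram x (k *: v) = k ^+ 2 * gram x v.
Proof. by rewrite /gram /disc !qfZ; ring. Qed.

Lemma gram_invariant (A : 'M[R]_n.+1) x v : (forall z, h (z *m A) = h z) ->
  gram (x *m A) (v *m A) = gram x v.
Proof.
move=> hA; have [|e1 e2] := @qf_invariant R n.+1 T (fun z => z *m A) _ hA x v.
  by move=> a b t; rewrite mulmxDl scalemxAl.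
by rewrite /gram /disc e1 e2 hA.
Qed.

Lemma disc_cvg (X : Type) (F : set_system X) (FF : Filter F) (f g : X -> 'rV[R]_n.+1) x v :
  f @ F --> x -> g @ F --> v -> (fun i => disc (f i) (g i)) @ F --> disc x v.
Proof.
move=> fx gv; rewrite /disc !expr2; under eq_fun do rewrite !expr2.
by apply: cvgB; apply: cvgM; apply: qf_cvg.
Qed.

Lemma gram_cvg (X : Type) (F : set_system X) (FF : Filter F) (f g : X -> 'rV[R]_n.+1) x v :
  f @ F --> x -> g @ F --> v -> (fun i => gram (f i) (g i)) @ F --> gram x v.
Proof.
move=> fx gv; rewrite /gram expr2; under eq_fun do rewrite expr2.
by apply: cvgD; [exact: disc_cvg | apply: cvgM; apply: qf_cvg].
Qed.

Lemma gram_lower_bound x : C x -> exists2 m, 0 < m & forall v, m * `|v| ^+ 2 <= gram x v.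
Proof.
move=> Cx; pose K := [set v : 'rV[R]_n.+1 | `|v| = 1].
have K0 : K !=set0.
  exists (`|const_mx 1 : 'rV[R]_n.+1|^-1 *: const_mx 1).
  rewrite /K /= normrZ normfV normr_id mulVf // normr_eq0.
  by apply/eqP => /rowP/(_ 0); rewrite !mxE => /eqP; rewrite oner_eq0.
have Kc : compact K.
  apply: bounded_closed_compact.
    by exists 1; split=> // t t1 v /= ->; exact: ltW.
  have -> : K = (fun v : 'rV[R]_n.+1 => `|v|) @^-1` [set 1] by [].
  apply: preimage_closed; first by move=> v _; apply: norm_continuous.
  exact: closed_eq.
have [|c Kc' cmin] := @compact_EVT_min _ R (gram x) K K0 Kc.
  apply: continuous_subspaceT => v.
  by apply: (@gram_cvg _ (nbhs v)); [apply: cvg_cst | apply: cvg_id].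
rewrite inE in Kc'.
have c0 : c != 0 by apply/eqP => c0; move: Kc'; rewrite /K /= c0 normr0; lra.
exists (gram x c) => [|v]; first exact: gram_gt0.
have [->|v0] := eqVneq v 0; first by rewrite normr0 /gram /disc !qf04; lra.
have nv : 0 < `|v| by rewrite normr_gt0.
have := cmin (`|v|^-1 *: v); rewrite inE /K /= normrZ normfV normr_id mulVf ?gt_eqF //.
move=> /(_ erefl); rewrite gramZr exprVn => le_c.
by rewrite -ler_pdivlMr ?exprn_gt0 // mulrC.
Qed.

Lemma fourth_root k : 0 < k -> exists2 c : R, 0 < c & c ^+ 4 = k.
Proof.
move=> k0; exists (Num.sqrt (Num.sqrt k)); first by rewrite !sqrtr_gt0.
by rewrite (exprM _ 2 2) !sqr_sqrtr ?sqrtr_ge0 ?ltW.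
Qed.

Lemma cone_uniform_ball : C !=set0 -> exists2 e, 0 < e &
  forall x w, C x -> gram x w <= e * h x ^+ 2 -> C (x + w).
Proof.
case=> x0 Cx0; have [m m0 mP] := gram_lower_bound Cx0.
have /nbhs_ballP[r r0 rP] : nbhs x0 C by exact: open_nbhs_nbhs.
have h0 := Cpos Cx0.
exists (m * r ^+ 2 / 2 / h x0 ^+ 2); first by rewrite !divr_gt0 ?mulr_gt0 ?exprn_gt0.
move=> x w Cx; have hx := Cpos Cx.
have [c c0 cE] := fourth_root (divr_gt0 hx h0).
have hcx : h (c *: x0) = h x by rewrite qf_scale cE divfK // gt_eqF.
have [A [Au Ax CA hA]] := Chom (Ccone c0 Cx0) Cx hcx.
pose u := c^-1 *: (w *m invmx A).
have wE : w = (c *: u) *m A by rewrite /u scalerA divff ?gt_eqF // scale1r mulmxKV.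
rewrite wE -Ax -mulmxDl -scalerDr => le_w.
apply/CA; apply: Ccone => //; apply: rP.
rewrite -ball_normE /ball_ /= opprD addNKr normrN.
move: le_w; rewrite gram_invariant // gramZ hA hcx => le_w.
have le_u := mP u.
rewrite -(@ltr_pXn2r _ 2) ?nnegrE ?(ltW r0) //.
have : h x = c ^+ 4 * h x0 by rewrite cE divfK // gt_eqF.
move=> hxE; move: le_w; rewrite hxE.
have -> : m * r ^+ 2 / 2 / h x0 ^+ 2 * (c ^+ 4 * h x0) ^+ 2 = c ^+ 8 * (m * r ^+ 2 / 2).
  by field; rewrite gt_eqF.
rewrite ler_pM2l ?exprn_gt0 // => le_g.
rewrite -(ltr_pM2l m0); apply: le_lt_trans le_u _; apply: le_lt_trans le_g _.
by have : 0 < m * r ^+ 2 by [rewrite mulr_gt0 // exprn_gt0]; lra.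
Qed.

Lemma closure_pos p : closure C p -> 0 < h p -> C p.
Proof.
move=> Cp hp; have [|e e0 eP] := cone_uniform_ball.
  by have [x [Cx _]] := Cp _ filterT; exists x.
have lim (F : set_system 'rV[R]_n.+1) (FF : Filter F) : F --> p ->
    (fun x => e * h x ^+ 2 - gram x (p - x)) @ F --> e * h p ^+ 2 - gram p (p - p).
  move=> Fp; apply: cvgB; last by apply: gram_cvg => //; apply: cvgB => //; apply: cvg_cst.
  apply: cvgM; first exact: cvg_cst.
  by rewrite expr2; under eq_fun do rewrite expr2; apply: cvgM; apply: qf_cvg.
have lim_gt0 : 0 < e * h p ^+ 2 - gram p (p - p).
  by rewrite subrr /gram /disc !qf04 expr0n mulr0 subr0 addr0 subr0 mulr_gt0 ?exprn_gt0.
have : \forall x \near p, 0 < e * h x ^+ 2 - gram x (p - x).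
  exact: (cvgr_gt _ (lim (nbhs p) _ (@cvg_id _ _)) _ lim_gt0).
move=> /Cp[x [Cx]]; rewrite /= subr_gt0 => /ltW lt_x.
by have := eP x _ Cx lt_x; rewrite addrC subrK.
Qed.

Lemma closure_ge0 p : closure C p -> 0 <= h p.
Proof.
move=> Cp; rewrite leNgt; apply/negP => hp.
have : \forall x \near p, h x < 0 by exact: (cvgr_lt _ (@qf_cont _ _ T p) _ hp).
by move=> /Cp[x [/Cpos hx]] /=; rewrite ltNge ltW.
Qed.

Lemma segment_min x v t : (forall s, 0 <= s <= 1 -> C (x + s *: v)) -> 0 <= t <= 1 ->
  h x <= h (x + t *: v) \/ h (x + v) <= h (x + t *: v).
Proof.
move=> xvC t01; have [->|v0] := eqVneq v 0; first by rewrite scaler0 addr0; left.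
have [s /andP[s0 s1] smin] := qf_argmin T x v (@ler01 R).
have [s_0|sn0] := eqVneq s 0.
  by left; have := smin t t01; rewrite s_0 scale0r addr0.
have [s_1|sn1] := eqVneq s 1.
  by right; have := smin t t01; rewrite s_1 scale1r.
have s_gt0 : 0 < s by rewrite lt_def sn0.
have s_lt1 : s < 1 by rewrite lt_neqAle sn1.
set y := x + s *: v; have yv r : y + r *: v = x + (s + r) *: v.
  by rewrite /y scalerDl addrA.
have ge1 : 0 <= T y y y v.
  apply: (@qf_min1 _ _ T _ _ (1 - s)); first by rewrite subr_gt0.
  by move=> r /andP[r0 r1]; rewrite yv; apply: smin; apply/andP; split; lra.
have le1 : 0 <= T y y y (- v).
  apply: (@qf_min1 _ _ T _ _ s) => // r /andP[r0 r1].
  by rewrite scalerN -scaleNr yv; apply: smin; apply/andP; split; lra.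
have T1 : T y y y v = 0.
  by apply/eqP; rewrite eq_le ge1 andbT -oppr_ge0 -mulN1r -qfZ4 scaleN1r.
have : T y y v v < 0 by apply: Clor => //; apply: xvC; rewrite s0 s1.
rewrite ltNge => /negP; case; apply: (@qf_min2 _ _ T _ _ (1 - s)) => //.
  by rewrite subr_gt0.
by move=> r /andP[r0 r1]; rewrite yv; apply: smin; apply/andP; split; lra.
Qed.

Variable x0 : 'rV[R]_n.+1.
Hypothesis Cx0 : C x0.

Definition visible : set 'rV[R]_n.+1 :=
  [set x | forall s t, 0 <= s -> 0 <= t -> 0 < s + t -> C (s *: x0 + t *: x)].

Lemma visible_cone x : visible x -> C x.
Proof.
by move=> /(_ 0 1 (lexx 0) ler01); rewrite scale0r !add0r scale1r; apply; exact: ltr01.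
Qed.

Lemma visibleD x s t : visible x -> 0 <= s -> 0 < t -> visible (s *: x0 + t *: x).
Proof.
move=> Vx s0 t0 a b a0 b0 ab; rewrite scalerDr !scalerA addrA -scalerDl.
have bs0 : 0 <= b * s by rewrite mulr_ge0.
have bt0 : 0 <= b * t by rewrite mulr_ge0 // ltW.
apply: Vx => //; first by rewrite addr_ge0.
have [b_0|bn0] := eqVneq b 0; first by rewrite b_0 !mul0r !addr0; rewrite b_0 in ab; lra.
by rewrite ltr_wpDl ?addr_ge0 // mulr_gt0 // lt_def bn0.
Qed.

Lemma visible_base : visible x0.
Proof. by move=> s t s0 t0 st; rewrite -scalerDl; apply: Ccone. Qed.

Lemma visibleP x : (forall t, 0 <= t <= 1 -> C (x0 + t *: (x - x0))) -> visible x.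
Proof.
move=> xC s t s0 t0 st.
have tst : 0 <= t / (s + t) <= 1.
  by rewrite divr_ge0 ?(ltW st) // ler_pdivrMr // mul1r lerDr.
have := Ccone st (xC _ tst); rewrite scalerDr scalerA mulrC divfK ?gt_eqF //.
by rewrite scalerBr scalerDl -addrA subrKC.
Qed.

Lemma visible_h_ge x s t : visible x -> 0 <= s -> 0 <= t ->
  (s + t) ^+ 4 * h x0 <= h (s *: x0 + t *: x) \/ (s + t) ^+ 4 * h x <= h (s *: x0 + t *: x).
Proof.
move=> Vx s0 t0; rewrite -!qf_scale.
have [st|st] := ltP 0 (s + t); last first.
  have [-> ->] : s = 0 /\ t = 0 by split; lra.
  by rewrite !addr0 !scale0r !addr0; left.
have tst : 0 <= t / (s + t) <= 1.
  by rewrite divr_ge0 ?(ltW st) // ler_pdivrMr // mul1r lerDr.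
have along r : (s + t) *: x0 + r *: ((s + t) *: (x - x0)) =
    ((s + t) * (1 - r)) *: x0 + ((s + t) * r) *: x.
  by rewrite scalerA scalerBr mulrBr mulr1 scalerBl [r * _]mulrC addrCA addrC.
have := @segment_min ((s + t) *: x0) ((s + t) *: (x - x0)) _ _ tst.
rewrite along -scalerDr subrKC; have -> : (s + t) * (1 - t / (s + t)) = s.
  by field; rewrite gt_eqF.
rewrite mulrC divfK ?gt_eqF //; apply=> r /andP[r0 r1]; rewrite along.
by apply: Vx; [apply: mulr_ge0; lra | apply: mulr_ge0; lra |]; rewrite -mulrDr subrK mulr1.
Qed.

Lemma closure_visible_le x t : closure visible x -> 0 <= t -> h x0 <= h (x0 + t *: x).
Proof.
suff vis y r : visible y -> 0 <= r -> h x0 <= h (x0 + r *: y).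
  move=> Vx t0; rewrite leNgt; apply/negP => lt_h.
  have : \forall y \near x, h (x0 + t *: y) < h x0.
    have lim : (fun y => h (x0 + t *: y)) @ x --> h (x0 + t *: x).
      by apply: (@qf_cvg _ _ T _ (nbhs x)); apply: cvg_affine; apply: cvg_id.
    exact: (cvgr_lt _ lim _ lt_h).
  by move=> /Vx[y [Vy]] /=; rewrite ltNge vis.
move=> Vy r0.
have hy := Cpos (visible_cone Vy); have h0 := Cpos Cx0.
have [s s0 sE] := fourth_root (divr_gt0 h0 hy).
have {sE} sE : h (s *: y) = h x0 by rewrite qf_scale sE divfK // gt_eqF.
have Vsy : visible (s *: y) by rewrite -[s *: y]add0r -(scale0r x0); apply: visibleD.
have rs0 : 0 <= r / s by rewrite divr_ge0 // ltW.
have := visible_h_ge Vsy ler01 rs0; rewrite scale1r scalerA divfK ?gt_eqF // sE => le_h.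
have : 1 <= (1 + r / s) ^+ 4 by rewrite exprn_ege1 // lerDl.
by move=> ge1; have : h x0 <= (1 + r / s) ^+ 4 * h x0; [rewrite ler_peMl // ltW | case: le_h; lra].
Qed.

Lemma visible_open : open visible.
Proof.
rewrite openE => x Vx.
have near_C t : `[0, 1]%classic t ->
    \forall t' \near t & y \near x, C (x0 + t' *: (y - x0)).
  rewrite /= in_itv /= => /andP[t0 t1].
  have lim : (fun q : R * 'rV[R]_n.+1 => x0 + q.1 *: (q.2 - x0)) @
      filter_prod (nbhs t) (nbhs x) --> x0 + t *: (x - x0).
    apply: (cvgD (cvg_cst _)); apply: cvgZ; first exact: cvg_fst.
    by apply: cvgB; [exact: cvg_snd | apply: cvg_cst].
  apply: lim; apply: open_nbhs_nbhs; split=> //.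
  rewrite scalerBr addrCA addrC -{1}[x0]scale1r -scalerBl.
  by apply: Vx; lra.
have /compact_near_coveringP cover := @segment_compact R 0 1.
have near_V := cover _ (nbhs x) (fun y t => C (x0 + t *: (y - x0))) (nbhs_filter x) near_C.
apply: (@filterS _ (nbhs x) (nbhs_filter x) _ _ _ near_V) => y yC; apply: visibleP => t t01.
by apply: (yC t); rewrite /= in_itv.
Qed.

Lemma visible_closed x : closure visible x -> 0 < h x -> visible x.
Proof.
move=> Vx hx s t s0 t0 st; set z := s *: x0 + t *: x.
have limz : (fun y => s *: x0 + t *: y) @ x --> z.
  by apply: (@cvg_affine _ _ _ (nbhs x)); apply: cvg_id.
apply: closure_pos.
  move=> B zB; have /Vx[y [Vy By]] := limz B zB.
  by exists (s *: x0 + t *: y); split=> //; apply: Vy.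
rewrite ltNge; apply/negP => hz.
pose k := (s + t) ^+ 4 * Num.min (h x0) (h x / 2).
have k0 : 0 < k by rewrite mulr_gt0 ?exprn_gt0 // lt_min Cpos // divr_gt0.
have limh : (fun y => h (s *: x0 + t *: y)) @ x --> h z.
  by apply: (@qf_cvg _ _ T _ (nbhs x)).
have near_k : \forall y \near x, h (s *: x0 + t *: y) < k.
  by exact: (cvgr_lt _ limh _ (le_lt_trans hz k0)).
have hx2 : h x / 2 < h x by lra.
have near_h : \forall y \near x, h x / 2 < h y.
  by exact: (cvgr_gt _ (@qf_cont _ _ T x) _ hx2).
have [y [Vy [lt_k lt_h]]] := Vx _ (filterI near_k near_h).
have st4 : 0 < (s + t) ^+ 4 by rewrite exprn_gt0.
move: lt_k; rewrite ltNge => /negP; apply.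
case: (visible_h_ge Vy s0 t0); apply: le_trans; rewrite ler_pM2l // ge_min ?lexx //.
by rewrite (ltW lt_h) orbT.
Qed.

Lemma visible_segment y z : visible y ->
  (forall s, 0 <= s <= 1 -> 0 < h (y + s *: (z - y))) -> visible z.
Proof.
move=> Vy pos; pose path (s : R) := y + s *: (z - y).
have path_cont : continuous path.
  by move=> s; apply: (@cvg_along _ _ _ (nbhs s)); apply: cvg_id.
have := @segment_connected R 0 1 (`[0, 1] `&` path @^-1` visible).
have -> : visible z = (path @^-1` visible) 1 by rewrite /= /path scale1r subrKC.
suff conn P : P = `[(0 : R), 1]%classic `&` path @^-1` visible -> P = `[(0 : R), 1]%classic ->
    (path @^-1` visible) 1.
  move=> H; apply: (conn _ erefl); apply: H.
  - by exists 0; split; rewrite /= /path ?in_itv /= ?lexx ?ler01 // scale0r addr0.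
  - exists (path @^-1` visible) => //; apply: open_comp; last exact: visible_open.
    by move=> s _; apply: path_cont.
  - exists (path @^-1` closure visible).
      apply: preimage_closed; last exact: closed_closure.
      by move=> s _; apply: path_cont.
    apply/seteqP; split=> s [s01 Vs]; split=> //; first exact: subset_closure.
    by apply: visible_closed => //; apply: pos; move: s01; rewrite /= in_itv.
move=> PE P01; have : P 1 by rewrite P01 /= in_itv /= lexx ler01.
by rewrite PE => -[].
Qed.

Local Notation al := (T x0 x0 x0).

Lemma closure_visible_pos x : closure visible x -> x != 0 -> 0 < al x.
Proof.
move=> Vx xn0; have le_h s : 0 < s < 1 -> h x0 <= h (x0 + s *: x).
  by case/andP=> s0 _; apply: closure_visible_le => //; exact: ltW.
have := qf_min1 ltr01 le_h; rewrite le_eqVlt => /orP[/eqP/esym al0|//].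
have := qf_min2 ltr01 le_h al0.
by rewrite leNgt Clor.
Qed.

Lemma touching_point : exists p, [/\ closure visible p, p != 0 &
  forall v, closure visible v -> disc x0 v * al p ^+ 2 <= disc x0 p * al v ^+ 2].
Proof.
have closureZ v t : 0 < t -> closure visible v -> closure visible (t *: v).
  move=> t0 Vv B tvB; have lim : (fun y => 0 *: x0 + t *: y) @ v --> 0 *: x0 + t *: v.
    by apply: (@cvg_affine _ _ _ (nbhs v)); apply: cvg_id.
  have [|y [Vy By]] := Vv _ (lim B _); first by rewrite scale0r add0r.
  by exists (0 *: x0 + t *: y); split=> //; apply: visibleD.
have unit_norm v : v != 0 -> `| `|v|^-1 *: v| = 1.
  by move=> v0; rewrite normrZ normfV normr_id mulVf // normr_eq0.
have x0n0 : x0 != 0.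
  by apply/eqP => x00; have := Cpos Cx0; rewrite x00 qf04 ltxx.
pose K := closure visible `&` [set v : 'rV[R]_n.+1 | `|v| = 1].
have K0 : K !=set0.
  exists (`|x0|^-1 *: x0); split; last exact: unit_norm.
  apply: closureZ; first by rewrite invr_gt0 normr_gt0.
  exact/subset_closure/visible_base.
have Kn0 v : K v -> v != 0.
  by move=> [_ /= v1]; apply/eqP => v0; move: v1; rewrite v0 normr0; lra.
have Kpos v : K v -> 0 < al v.
  by move=> Kv; apply: closure_visible_pos; [exact: Kv.1 | exact: Kn0].
have Kc : compact K.
  apply: bounded_closed_compact.
    by exists 1; split=> // t t1 v [_ /= ->]; exact: ltW.
  apply: closedI; first exact: closed_closure.
  have -> : [set v | `|v| = 1] = (fun v : 'rV[R]_n.+1 => `|v|) @^-1` [set 1] by [].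
  apply: preimage_closed; first by move=> v _; apply: norm_continuous.
  exact: closed_eq.
have [|p Kp pmax] := @compact_EVT_max _ R (fun v => disc x0 v / al v ^+ 2) K K0 Kc.
  apply: continuous_in_subspaceT => v; rewrite inE => Kv.
  apply: (@cvgM _ _ (nbhs v)).
    by apply: (@disc_cvg _ (nbhs v)); [apply: cvg_cst | apply: cvg_id].
  apply: (@cvgV _ _ (nbhs v)); first by rewrite expf_neq0 // gt_eqF // Kpos.
  rewrite expr2; under eq_fun do rewrite expr2.
  by apply: (@cvgM _ _ (nbhs v)); apply: (@qf_cvg _ _ T _ (nbhs v));
    (apply: cvg_cst || apply: cvg_id).
rewrite inE in Kp; exists p; split; [exact: Kp.1 | exact: Kn0 |].
move=> v Vv; have [->|v0] := eqVneq v 0.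
  by rewrite /disc !qf04 !(mulr0, mul0r, expr0n) subr0 mul0r.
have Kv : K (`|v|^-1 *: v).
  by split; [apply: closureZ => //; rewrite invr_gt0 normr_gt0 | exact: unit_norm].
have := pmax _ (mem_set Kv); rewrite /disc !qfZ.
have := Kpos _ Kp; have := closure_visible_pos Vv v0.
set a := al v; set b := al p => a0 b0.
have -> : ((`|v|^-1 * a) ^+ 2 - h x0 * (`|v|^-1 * (`|v|^-1 * T x0 x0 v v))) /
    (`|v|^-1 * a) ^+ 2 = (a ^+ 2 - h x0 * T x0 x0 v v) / a ^+ 2.
  by field; rewrite normr_eq0 v0 gt_eqF.
by rewrite ler_pdivrMr ?exprn_gt0 // mulrAC ler_pdivlMr ?exprn_gt0.
Qed.

Lemma polar_kernel_nontrivial : (1 <= n)%N -> exists2 v, v != 0 & al v = 0.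
Proof.
move=> n1; pose i1 : 'I_n.+1 := inord 1.
pose e (i : 'I_n.+1) : 'rV[R]_n.+1 := delta_mx 0 i.
have i10 : (i1 == ord0) = false by rewrite -val_eqE /= inordK.
have [e0|e0] := eqVneq (al (e ord0)) 0.
  by exists (e ord0) => //; apply/eqP => /rowP/(_ ord0)/eqP; rewrite !mxE !eqxx oner_eq0.
exists (al (e i1) *: e ord0 - al (e ord0) *: e i1).
  apply/eqP => /rowP/(_ i1)/eqP; rewrite !mxE !eqxx i10 /=.
  by rewrite mulr0 mulr1 sub0r oppr_eq0 (negPf e0).
by rewrite -scaleNr !(qfD, qfZ); ring.
Qed.

Variable p : 'rV[R]_n.+1.
Hypothesis n_gt0 : (1 <= n)%N.
Hypothesis Vp : closure visible p.
Hypothesis p_neq0 : p != 0.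
Hypothesis p_max : forall v, closure visible v ->
  disc x0 v * al p ^+ 2 <= disc x0 p * al v ^+ 2.

Lemma closure_visible_C v : closure visible v -> closure C v.
Proof. by apply: closure_subset => x; exact: visible_cone. Qed.

Lemma touching_al : 0 < al p. Proof. exact: closure_visible_pos. Qed.

Lemma touching_h : h p = 0.
Proof.
apply/eqP; rewrite eq_le closure_ge0 ?andbT; last exact: closure_visible_C.
rewrite leNgt; apply/negP => hp; have hV := visible_closed Vp hp.
have al0 := touching_al.
have [w alw w_up] : exists2 w, al w = 0 &
    forall s, 0 < s -> disc x0 p < disc x0 (p + s *: w).
  pose w := p - (al p / h x0) *: x0.
  have alw : al w = 0 by exact: polar_proj.
  have pE s : p + s *: w = ((1 + s) *: w) + (al p / h x0) *: x0.
    by rewrite scalerDl scale1r addrAC subrK.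
  have [w0|w0] := eqVneq w 0.
    have [v v0 alv] := polar_kernel_nontrivial n_gt0.
    exists v => // s s0; have := pE 0; rewrite w0 !scaler0 addr0 add0r => ->.
    rewrite -[X in disc x0 X]add0r [in X in _ < X]addrC !disc_shift.
    rewrite {1}/disc !qf04 expr0n mulr0 subr0.
    by apply: disc_gt0; rewrite // ?qfZ ?alv ?mulr0 // scaler_eq0 negb_or gt_eqF.
  exists w => // s s0; rewrite pE disc_shift -(disc_proj x0 p (al p / h x0)) -/w.
  have d0 := disc_gt0 Cx0 alw w0.
  rewrite /disc !qfZ in d0 *; rewrite alw in d0 *.
  by have := mulr_gt0 s0 d0; have := mulr_gt0 (mulr_gt0 s0 s0) d0; nra.
have : nbhs p visible by apply: open_nbhs_nbhs; split=> //; exact: visible_open.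
have lim : (fun s : R => p + s *: w) @ (0 : R) --> p + 0 *: w.
  by apply: (@cvg_along _ _ _ (nbhs (0 : R))); apply: cvg_id.
rewrite -[X in nbhs X](addr0 p) -(scale0r w) => /lim /nbhs_ballP[e e0 eP].
have e20 : 0 < e / 2 by rewrite divr_gt0.
have Vs : visible (p + (e / 2) *: w).
  by apply: eP; rewrite /ball /= sub0r normrN gtr0_norm // ltr_pdivrMr // ltr_pMr // ltr1n.
have := p_max (subset_closure Vs); rewrite !(qfD, qfZ) alw mulr0 addr0.
by rewrite ler_pM2r ?exprn_gt0 // leNgt w_up.
Qed.

Variable u0 : 'rV[R]_n.+1.
Hypothesis pu0 : 0 < T p p p u0.

Lemma locally_visible : exists2 r, 0 < r &
  forall z, `|p - z| < r -> 0 < h z -> visible z.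
Proof.
have near_grad : \forall z \near p, 0 < T z z z u0.
  have lim : (fun z => T z z z u0) @ p --> T p p p u0.
    by apply: (@qf_cvg _ _ T _ (nbhs p)); (apply: cvg_id || apply: cvg_cst).
  exact: (cvgr_gt _ lim _ pu0).
have /nbhs_ballP[e e0 eP] := near_grad.
have n0 : 0 < `|u0| + 1 by rewrite ltr_wpDl.
pose d := e / 2 / (`|u0| + 1).
have d0 : 0 < d by rewrite !divr_gt0.
have incr z t : `|p - z| < e / 2 -> 0 < t <= d -> h z < h (z + t *: u0).
  move=> pz /andP[t0 td]; apply: qf_increasing => // s /andP[s0 st]; apply: eP.
  rewrite -ball_normE /ball_ /= opprD addrA; apply: le_lt_trans (ler_normB _ _) _.
  rewrite normrZ ger0_norm //; have : s * `|u0| <= d * (`|u0| + 1).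
    by apply: ler_pM => //; [exact: le_trans td | rewrite lerDl].
  by rewrite /d divfK ?gt_eqF // => le_s; lra.
pose q := p + d *: u0.
have hq : 0 < h q.
  by rewrite -[X in X < _]touching_h; apply: incr; [rewrite subrr normr0 divr_gt0 | rewrite lexx andbT].
have near_q : \forall z \near q, 0 < h z by exact: (cvgr_gt _ (@qf_cont _ _ T q) _ hq).
have /nbhs_ballP[e2 e20 e2P] := near_q.
exists (Num.min (e / 2) e2); first by rewrite lt_min divr_gt0.
move=> z; rewrite lt_min => /andP[pz pz2] hz.
have [y [Vy]] : visible `&` ball p (Num.min (e / 2) e2) !=set0.
  by apply: Vp; apply: nbhsx_ballx; rewrite lt_min divr_gt0.
rewrite -ball_normE /ball_ /= lt_min => /andP[py py2].
have hy : 0 < h y by apply/Cpos/visible_cone.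
have lift x s : `|p - x| < e / 2 -> 0 < h x -> 0 <= s <= 1 -> 0 < h (x + s *: (d *: u0)).
  move=> px hx /andP[s0 s1]; have [->|sn0] := eqVneq s 0; first by rewrite scale0r addr0.
  rewrite scalerA; apply: lt_trans hx _; apply: incr => //.
  have s_gt0 : 0 < s by rewrite lt_def sn0.
  by rewrite mulr_gt0 //= ger_pMl.
have Vy1 : visible (y + d *: u0).
  by apply: (visible_segment Vy) => s s01; rewrite [y + d *: u0 - y]addrAC subrr add0r lift.
have Vz1 : visible (z + d *: u0).
  apply: (visible_segment Vy1) => s /andP[s0 s1]; apply: e2P.
  rewrite -ball_normE /ball_ /=.
  have -> : q - (y + d *: u0 + s *: (z + d *: u0 - (y + d *: u0))) =
      (1 - s) *: (p - y) + s *: (p - z).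
    by apply/rowP => i; rewrite !mxE; ring.
  apply: le_lt_trans (ler_normD _ _) _; rewrite !normrZ !ger0_norm ?subr_ge0 //.
  have [->|s_neq1] := eqVneq s 1; first by rewrite subrr mul0r add0r mul1r.
  have s_lt1 : 0 < 1 - s by rewrite subr_gt0 lt_neqAle s_neq1.
  have := ler_wpM2l s0 (ltW pz2).
  by move: py2; rewrite -(ltr_pM2l s_lt1); lra.
apply: (visible_segment Vz1) => s /andP[s0 s1].
have -> : z + d *: u0 + s *: (z - (z + d *: u0)) = z + (1 - s) *: (d *: u0).
  by apply/rowP => i; rewrite !mxE; ring.
by apply: lift => //; apply/andP; split; lra.
Qed.

(* [tform] is the polar form at [p], and [tquad] the value at [z], of the
   quadratic form [disc x0 p * al ^ 2 - al p ^ 2 * disc x0], which is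
   nonnegative on visible points and vanishes at [p]. *)
Let tform z := disc x0 p * al p * al z - al p ^+ 2 * (al p * al z - h x0 * T x0 x0 p z).
Let tquad z := disc x0 p * al z ^+ 2 - al p ^+ 2 * disc x0 z.

Let tquad_along z s : disc x0 p * al (p + s *: z) ^+ 2 - disc x0 (p + s *: z) * al p ^+ 2 =
  2 * s * tform z + s ^+ 2 * tquad z.
Proof.
by rewrite /tform /tquad /disc !(qfD, qfZ) (qf_swap34 T _ _ z p); ring.
Qed.

Let tform_lin w u s : tform (w + s *: u) = tform w + s * tform u.
Proof. by rewrite /tform !(qfD, qfZ); ring. Qed.

Lemma touching_ineq w u : T p p p w = 0 -> 0 < 4 * T p p p u + 6 * T p p w w ->
  0 <= tform w /\ (tform w = 0 -> 0 <= 2 * tform u + tquad w).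
Proof.
move=> pw pos.
pose z s := w + s *: u.
pose phi s := 4 * T p p p u + 6 * T p p (z s) (z s) +
  4 * s * T p (z s) (z s) (z s) + s ^+ 2 * h (z s).
have limz (F : set_system R) (FF : Filter F) (s : R) : F --> s -> z @ F --> z s.
  by move=> Fs; apply: cvg_along.
have lim_phi (F : set_system R) (FF : Filter F) (s : R) : F --> s -> phi @ F --> phi s.
  move=> Fs; have lz := limz F FF s Fs; rewrite /phi expr2.
  under eq_fun do rewrite expr2.
  have lT (a b c d : R -> 'rV[R]_n.+1) : a @ F --> a s -> b @ F --> b s -> c @ F --> c s -> d @ F --> d s ->
    (fun i => T (a i) (b i) (c i) (d i)) @ F --> T (a s) (b s) (c s) (d s).
    exact: qf_cvg.
  have cp : (fun=> p) @ F --> p by exact: cvg_cst.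
  apply: cvgD; [apply: cvgD; [apply: cvgD; [exact: cvg_cst|] |] |].
  - by apply: cvgM; [exact: cvg_cst | exact: (lT (fun=> p) (fun=> p))].
  - apply: cvgM; first by apply: cvgM; [exact: cvg_cst | exact: Fs].
    exact: (lT (fun=> p)).
  - by apply: cvgM; [apply: cvgM | exact: lT].
have hphi s : h (p + s *: z s) = s ^+ 2 * phi s.
  have pz : T p p p (z s) = s * T p p p u by rewrite /z qfD4 qfZ4 pw add0r.
  by rewrite qf_along touching_h pz /phi; ring.
have phi0 : 0 < phi 0.
  by rewrite /phi /z scale0r addr0; move: pos; lra.
have [d1 d10 d1P] := germ_gt0 (lim_phi (nbhs (0 : R)) _ 0 (@cvg_id _ _)) phi0.
have [r r0 rP] := locally_visible.
have near_r : \forall s \near (0 : R), `|s *: z s| < r.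
  have lim : (fun s => `|s *: z s|) @ (0 : R) --> `|0 *: z 0|.
    have gen (F : set_system R) (FF : Filter F) : F --> (0 : R) ->
        (fun s => `|s *: z s|) @ F --> `|0 *: z 0|.
      by move=> F0; apply: cvg_norm; apply: cvgZ => //; apply: limz.
    exact: (gen (nbhs (0 : R)) _ (@cvg_id _ _)).
  by apply: (cvgr_lt _ lim); rewrite scale0r normr0.
have /nbhs_ballP[d2 d20 d2P] := near_r.
pose d := Num.min d1 d2.
have d0 : 0 < d by rewrite lt_min d10 d20.
have key s : 0 < s < d -> 0 <= 2 * s * tform (z s) + s ^+ 2 * tquad (z s).
  move=> /andP[s0]; rewrite lt_min => /andP[sd1 sd2].
  rewrite -tquad_along subr_ge0; apply/p_max/subset_closure/rP.
    rewrite opprD addrA subrr sub0r normrN; apply: d2P.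
    by rewrite /ball /= sub0r normrN gtr0_norm.
  by rewrite hphi mulr_gt0 ?exprn_gt0 // d1P // gtr0_norm.
have tq s : tquad (z s) = tquad w + s * (tquad (w + u) - tquad w - tquad u) + s ^+ 2 * tquad u.
  rewrite /z /tquad /disc !(qfD, qfZ) (qf_swap34 T _ _ u w); ring.
split.
  rewrite -(pmulr_rge0 _ (ltr0n R 2)).
  apply: (germ_ge0 (cubic_cvg (2 * tform u + tquad w)
    (tquad (w + u) - tquad w - tquad u) (tquad u)) d0).
  move=> s /[dup] /key key_s /andP[s0 _]; rewrite -(pmulr_rge0 _ s0).
  by move: key_s; rewrite tform_lin tq; congr (0 <= _); ring.
move=> tw0.
apply: (germ_ge0 (cubic_cvg (tquad (w + u) - tquad w - tquad u) (tquad u) 0) d0).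
move=> s /[dup] /key key_s /andP[s0 _]; rewrite -(pmulr_rge0 _ (exprn_gt0 2 s0)).
by move: key_s; rewrite tform_lin tq tw0; congr (0 <= _); ring.
Qed.

Lemma touching_tangent w : T p p p w = 0 -> 0 <= T p p w w -> w = (al w / al p) *: p.
Proof.
move=> pw pww; have al0 := touching_al.
have pos k v : 0 < k -> T p p v v = T p p w w -> 0 < 4 * T p p p (k *: u0) + 6 * T p p v v.
  by move=> k0 ->; rewrite qfZ; have := mulr_gt0 k0 pu0; lra.
have [ge0 _] := touching_ineq pw (pos 1 w ltr01 erefl).
have wN : T p p (- w) (- w) = T p p w w by rewrite -scaleN1r !qfZ; ring.
have pwN : T p p p (- w) = 0 by rewrite -scaleN1r qfZ pw mulr0.
have [le0 _] := touching_ineq pwN (pos 1 _ ltr01 wN).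
have tw0 : tform w = 0.
  apply/eqP; rewrite eq_le ge0 andbT -oppr_ge0.
  by move: le0; rewrite -scaleN1r -[-1 *: w]add0r tform_lin {1}/tform !qf04; lra.
have tq0 : 0 <= tquad w.
  apply: (germ_ge0 (cubic_cvg (2 * tform u0) 0 0) (@ltr01 R)) => k /andP[k0 _].
  have [_ /(_ tw0)] := touching_ineq pw (pos k w k0 erefl).
  by rewrite -[k *: u0]add0r tform_lin {1}/tform !qf04; lra.
set k := al w / al p; have alw : al w = k * al p by rewrite /k divfK // gt_eqF.
have alwp : al (w - k *: p) = 0 by rewrite -scaleNr !(qfD, qfZ) alw; ring.
apply/eqP; rewrite -subr_eq0; apply/negP => /negP wp0.
have := disc_gt0 Cx0 alwp wp0; rewrite -(pmulr_rgt0 _ (exprn_gt0 2 al0)).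
have -> : al p ^+ 2 * disc x0 (w - k *: p) = 2 * k * tform w - tquad w.
  rewrite /tform /tquad /disc -scaleNr !(qfD, qfZ) (qf_swap34 T _ _ w p) alw.
  by ring.
by rewrite tw0; lra.
Qed.

Lemma touching_transversal : 0 < T p p p x0.
Proof.
have le_h s : 0 < s < 1 -> h p <= h (p + s *: x0).
  move=> /andP[s0 _]; rewrite touching_h; apply/closure_ge0/closure_visible_C.
  move=> B pB; have lim : (fun y => s *: x0 + 1 *: y) @ p --> s *: x0 + 1 *: p.
    by apply: (@cvg_affine _ _ _ (nbhs p)); apply: cvg_id.
  have [|y [Vy By]] := Vp (lim B _); first by rewrite scale1r addrC.
  by exists (s *: x0 + 1 *: y); split=> //; apply: visibleD => //; exact: ltW.
have := qf_min1 ltr01 le_h; rewrite le_eqVlt => /orP[/eqP/esym px0|//].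
have := touching_tangent px0 (qf_min2 ltr01 le_h px0) => x0E.
by have := Cpos Cx0; rewrite x0E qf_scale touching_h mulr0 ltxx.
Qed.

Local Notation beta0 := (T p p p x0).

Let bc v := T p p p v / beta0.
Let ac v := (al v - bc v * h x0) / al p.
Let wc v := v - ac v *: p - bc v *: x0.
Let zc (e : R) v := wc v + e ^+ 2 *: (bc v *: x0).
Let dil (e : R) v := ac v *: p + e ^+ 2 *: zc e v.

Let beta0_neq0 : beta0 != 0. Proof. by rewrite gt_eqF // touching_transversal. Qed.
Let alp_neq0 : al p != 0. Proof. by rewrite gt_eqF // touching_al. Qed.

Let bcL x k v : bc (x + k *: v) = bc x + k * bc v.
Proof. by rewrite /bc !(qfD, qfZ) mulrDl mulrA. Qed.

Let acL x k v : ac (x + k *: v) = ac x + k * ac v.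
Proof. by rewrite /ac bcL !(qfD, qfZ); field. Qed.

Let wcL x k v : wc (x + k *: v) = wc x + k *: wc v.
Proof. by rewrite /wc acL bcL; apply/rowP => i; rewrite !mxE; ring. Qed.

Let dilL e x k v : dil e (x + k *: v) = dil e x + k *: dil e v.
Proof. by rewrite /dil /zc acL bcL wcL; apply/rowP => i; rewrite !mxE; ring. Qed.

Let wc_beta v : T p p p (wc v) = 0.
Proof.
by rewrite /wc !(qfD4, qfN4, qfZ4) touching_h /bc; field.
Qed.

Let wc_al v : al (wc v) = 0.
Proof. by rewrite /wc !(qfD4, qfN4, qfZ4) /ac; field. Qed.

Let bc_x0 : bc x0 = 1. Proof. by rewrite /bc divff. Qed.
Let ac_x0 : ac x0 = 0. Proof. by rewrite /ac bc_x0 mul1r subrr mul0r. Qed.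
Let wc_x0 : wc x0 = 0. Proof. by rewrite /wc ac_x0 bc_x0 scale0r scale1r subr0 subrr. Qed.
Let bc_p : bc p = 0. Proof. by rewrite /bc touching_h mul0r. Qed.
Let ac_p : ac p = 1. Proof. by rewrite /ac bc_p mul0r subr0 divff. Qed.
Let wc_p : wc p = 0. Proof. by rewrite /wc ac_p bc_p scale0r scale1r subr0 subrr. Qed.

Let px0E : p + x0 = p + 1 *: x0. Proof. by rewrite scale1r. Qed.

Let dil_px0 e : dil e (p + x0) = p + e ^+ 4 *: x0.
Proof.
rewrite px0E dilL /dil /zc ac_p bc_p wc_p ac_x0 bc_x0 wc_x0.
by apply/rowP => i; rewrite !mxE; ring.
Qed.

Let dil_x0 e : dil e x0 = e ^+ 4 *: x0.
Proof.
rewrite /dil /zc ac_x0 bc_x0 wc_x0.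
by apply/rowP => i; rewrite !mxE; ring.
Qed.

(* [e ^ 4 * phi e v], [e ^ 4 * psi1 e v] and [e ^ 4 * psi2 e v] are the values
   of [h] and of its polar forms at the dilated vectors. *)
Let phi v (e : R) := 4 * (ac v ^+ 3 * (bc v * beta0)) +
  6 * T (ac v *: p) (ac v *: p) (zc e v) (zc e v) +
  4 * (e * e) * T (ac v *: p) (zc e v) (zc e v) (zc e v) +
  (e * e) * (e * e) * h (zc e v).

Let psi1 v (e : R) := bc v * beta0 + 3 * T p p x0 (dil e v) +
  3 * ((e * e) * (e * e)) * T p x0 x0 (dil e v) +
  ((e * e) * (e * e)) * ((e * e) * (e * e)) * T x0 x0 x0 (dil e v).

Let psi2 v (e : R) := 2 * (ac v * (bc v * beta0)) + T p p (zc e v) (zc e v) +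
  2 * T p x0 (dil e v) (dil e v) + (e * e) * (e * e) * T x0 x0 (dil e v) (dil e v).

Let beta_zc e v : T p p p (zc e v) = e ^+ 2 * (bc v * beta0).
Proof. by rewrite /zc qfD4 !qfZ4 wc_beta add0r. Qed.

Let h_dil e v : h (dil e v) = e ^+ 4 * phi v e.
Proof.
rewrite /dil qf_along /phi; set z := zc e v.
have -> : T (ac v *: p) (ac v *: p) (ac v *: p) z = ac v ^+ 3 * (e ^+ 2 * (bc v * beta0)).
  by rewrite -beta_zc !qfZ; ring.
by rewrite qf_scale touching_h; ring.
Qed.

Let polar_dil e v : T (dil e (p + x0)) (dil e (p + x0)) (dil e (p + x0)) (dil e v) =
  e ^+ 4 * psi1 v e.
Proof.
rewrite dil_px0; have beta_dil : T p p p (dil e v) = e ^+ 4 * (bc v * beta0).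
  by rewrite /dil qfD4 !qfZ4 touching_h beta_zc; ring.
rewrite !(qfD1, qfD2, qfD3, qfZ1, qfZ2, qfZ3) beta_dil /psi1.
rewrite !(qf_swap12 T x0 p, qf_swap23 T _ x0 p).
by ring.
Qed.

Let polar2_dil e v : T (dil e (p + x0)) (dil e (p + x0)) (dil e v) (dil e v) =
  e ^+ 4 * psi2 v e.
Proof.
rewrite dil_px0; have beta_dil : T p p (dil e v) (dil e v) =
    e ^+ 4 * (2 * (ac v * (bc v * beta0)) + T p p (zc e v) (zc e v)).
  rewrite /dil; move: (zc e v) (beta_zc e v) => z pz.
  by rewrite !(qfD, qfZ) (qf_swap34 T _ _ z p) touching_h pz; ring.
rewrite /psi2; move: (dil e v) beta_dil => y py.
rewrite !(qfD1, qfD2, qfZ1, qfZ2) py (qf_swap12 T x0 p).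
by ring.
Qed.

Let limits (F : set_system R) (FF : Filter F) (e : R) v : F --> e ->
  [/\ phi v @ F --> phi v e, psi1 v @ F --> psi1 v e & psi2 v @ F --> psi2 v e].
Proof.
move=> Fe; have lE : (fun i => i * i) @ F --> e * e by apply: cvgM.
have lz : (fun i => zc i v) @ F --> zc e v.
  rewrite /zc expr2; under eq_fun do rewrite expr2.
  exact: cvg_along.
have ld : (fun i => dil i v) @ F --> dil e v.
  rewrite /dil expr2; under eq_fun do rewrite expr2.
  by apply: (cvgD (cvg_cst _)); apply: cvgZ.
have lc (k : R) : (fun=> k) @ F --> k by exact: cvg_cst.
have lcv (k : 'rV[R]_n.+1) : (fun=> k) @ F --> k by exact: cvg_cst.
have lE2 : (fun i => (i * i) * (i * i)) @ F --> (e * e) * (e * e) by apply: cvgM.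
have lT (a b c d : R -> 'rV[R]_n.+1) x y z w :
    a @ F --> x -> b @ F --> y -> c @ F --> z -> d @ F --> w ->
    (fun i => T (a i) (b i) (c i) (d i)) @ F --> T x y z w.
  exact: qf_cvg.
split.
- apply: cvgD; [apply: cvgD; [apply: cvgD; first exact: lc|] |].
  + apply: (cvgM (lc _)).
    exact: (lT _ _ _ _ _ _ _ _ (lcv (ac v *: p)) (lcv (ac v *: p)) lz lz).
  + apply: (cvgM (cvgM (lc _) lE)).
    exact: (lT _ _ _ _ _ _ _ _ (lcv (ac v *: p)) lz lz lz).
  + exact: (cvgM lE2 (lT _ _ _ _ _ _ _ _ lz lz lz lz)).
- apply: cvgD; [apply: cvgD; [apply: cvgD; first exact: lc|] |].
  + exact: (cvgM (lc _) (lT _ _ _ _ _ _ _ _ (lcv p) (lcv p) (lcv x0) ld)).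
  + apply: (cvgM (cvgM (lc _) lE2)).
    exact: (lT _ _ _ _ _ _ _ _ (lcv p) (lcv x0) (lcv x0) ld).
  + apply: (cvgM (cvgM lE2 lE2)).
    exact: (lT _ _ _ _ _ _ _ _ (lcv x0) (lcv x0) (lcv x0) ld).
- apply: cvgD; [apply: cvgD; [apply: cvgD; first exact: lc|] |].
  + exact: (lT _ _ _ _ _ _ _ _ (lcv p) (lcv p) lz lz).
  + exact: (cvgM (lc _) (lT _ _ _ _ _ _ _ _ (lcv p) (lcv x0) ld ld)).
  + exact: (cvgM lE2 (lT _ _ _ _ _ _ _ _ (lcv x0) (lcv x0) ld ld)).
Qed.

Let phi_0 v : phi v 0 = 4 * (ac v ^+ 3 * (bc v * beta0)) + 6 * (ac v ^+ 2 * T p p (wc v) (wc v)).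
Proof. by rewrite /phi /zc expr0n scale0r addr0 !qfZ; ring. Qed.

Let phi_px0 : phi (p + x0) 0 = 4 * beta0.
Proof.
rewrite phi_0 px0E acL bcL wcL ac_p ac_x0 bc_p bc_x0 wc_p wc_x0 scaler0 addr0.
by rewrite qf04; ring.
Qed.

Lemma blowup_step e : 0 < e -> 0 < phi (p + x0) e -> exists N : 'M[R]_n.+1,
  [/\ forall v, h (v *m N) * phi (p + x0) e = h x0 * phi v e,
      closure C (x0 *m N) &
      forall v, gram x0 (v *m N) * phi (p + x0) e ^+ 2 =
        h x0 ^+ 2 * (2 * psi1 v e ^+ 2 - phi (p + x0) e * psi2 v e)].
Proof.
move=> e0 pos; have h0 := Cpos Cx0.
have e40 : 0 < e ^+ 4 by rewrite exprn_gt0.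
have hq : 0 < h (dil e (p + x0)) by rewrite h_dil mulr_gt0.
have Cq : C (dil e (p + x0)).
  apply: visible_cone; apply: visible_closed => //; rewrite dil_px0 => B qB.
  have lim : (fun y => e ^+ 4 *: x0 + 1 *: y) @ p --> e ^+ 4 *: x0 + 1 *: p.
    by apply: (@cvg_affine _ _ _ (nbhs p)); apply: cvg_id.
  have [|y [Vy By]] := Vp (lim B _); first by rewrite scale1r addrC.
  by exists (e ^+ 4 *: x0 + 1 *: y); split=> //; apply: visibleD => //; exact: ltW.
have [c c0 cE] := fourth_root (divr_gt0 hq h0).
have hc : h (c *: x0) = h (dil e (p + x0)) by rewrite qf_scale cE divfK // gt_eqF.
have [A [Au Ax CA hA]] := Chom (Ccone c0 Cx0) Cq hc.
have hAV z : h (z *m invmx A) = h z by rewrite -[in RHS](mulmxKV Au z) hA.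
have CAV z : C z -> C (z *m invmx A) by rewrite -{1}(mulmxKV Au z) => /CA.
pose f v := c^-1 *: (dil e v *m invmx A).
have fL x k v : f (x + k *: v) = f x + k *: f v.
  by rewrite /f dilL mulmxDl -scalemxAl scalerDr !scalerA [c^-1 * k]mulrC.
have c4V : c^-1 ^+ 4 = h x0 / (e ^+ 4 * phi (p + x0) e) by rewrite exprVn cE h_dil invf_div.
have en0 : e != 0 by rewrite gt_eqF.
exists (\matrix_i f (delta_mx 0 i)); split=> [v||v]; rewrite mulmx_row_fun //.
- rewrite /f qf_scale hAV h_dil c4V; move: (phi v e) (phi (p + x0) e) pos => a b b0.
  by field; rewrite en0 !gt_eqF.
- apply: subset_closure; rewrite /f dil_x0; apply: Ccone; first by rewrite invr_gt0.
  by rewrite -scalemxAl; apply: Ccone => //; apply: CAV.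
have fx0 : f (p + x0) = x0.
  by rewrite /f -Ax mulmxK // scalerA mulVf ?scale1r ?gt_eqF.
have -> : gram x0 (f v) = gram (f (p + x0)) (f v) by rewrite fx0.
rewrite /f gramZ gram_invariant //.
have -> : gram (dil e (p + x0)) (dil e v) =
    e ^+ 8 * (2 * psi1 v e ^+ 2 - phi (p + x0) e * psi2 v e).
  by rewrite /gram /disc (h_dil e (p + x0)) polar_dil polar2_dil; ring.
rewrite (exprM _ 4 2) c4V; move: (psi1 v e) (psi2 v e) (phi (p + x0) e) pos => a1 a2 b b0.
by field; rewrite en0 !gt_eqF.
Qed.

Lemma blowup_limit : exists N : 'M[R]_n.+1,
  (forall v, h (v *m N) * (4 * beta0) = h x0 * phi v 0) /\ closure C (x0 *m N).
Proof.
have b0 : 0 < beta0 by exact: touching_transversal.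
have h0 := Cpos Cx0.
have to0 : 0^'+ --> (0 : R) by apply: cvg_within.
have limR v := limits (at_right_proper_filter 0) v to0.
have near_phi : \forall e \near 0^'+, 2 * beta0 < phi (p + x0) e.
  have [lphi _ _] := limR (p + x0); rewrite phi_px0 in lphi.
  have lt24 : 2 * beta0 < 4 * beta0 by lra.
  exact: (cvgr_gt _ lphi _ lt24).
have step e : exists N : 'M[R]_n.+1, 0 < e -> 0 < phi (p + x0) e ->
    [/\ forall v, h (v *m N) * phi (p + x0) e = h x0 * phi v e,
      closure C (x0 *m N) &
      forall v, gram x0 (v *m N) * phi (p + x0) e ^+ 2 =
        h x0 ^+ 2 * (2 * psi1 v e ^+ 2 - phi (p + x0) e * psi2 v e)].
  have [[e0 pe]|no] := pselect (0 < e /\ 0 < phi (p + x0) e).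
    by have [N NP] := blowup_step e0 pe; exists N.
  by exists 0 => e0 pe; case: no.
have [Nf NfP] := choice step.
have near_N : \forall e \near 0^'+, 0 < e /\ 2 * beta0 < phi (p + x0) e.
  by apply: filterI => //; exact: nbhs_right_gt.
have [m m0 mP] := gram_lower_bound Cx0.
have bound v : exists B, \forall e \near 0^'+, `|v *m Nf e| <= B.
  have [lphi _ _] := limR (p + x0); have [_ lpsi1 lpsi2] := limR v.
  have lim : (fun e => 2 * (psi1 v e * psi1 v e) - phi (p + x0) e * psi2 v e) @ 0^'+ -->
      2 * (psi1 v 0 * psi1 v 0) - phi (p + x0) 0 * psi2 v 0.
    exact: (cvgB (cvgM (cvg_cst _) (cvgM lpsi1 lpsi1)) (cvgM lphi lpsi2)).
  set l := (X in _ --> X) in lim.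
  have near_l : \forall e \near 0^'+, 2 * (psi1 v e * psi1 v e) - phi (p + x0) e * psi2 v e < l + 1.
    have lt1 : l < l + 1 by lra.
    exact: (cvgr_lt _ lim _ lt1).
  exists (1 + h x0 ^+ 2 * (l + 1) / (m * (2 * beta0) ^+ 2)).
  apply: filterS2 near_N near_l => e [e0 pe] le_l.
  have pe0 : 0 < phi (p + x0) e by apply: lt_trans pe; rewrite mulr_gt0.
  have [_ _ /(_ v) gE] := NfP e e0 pe0.
  set x := `|v *m Nf e|.
  suff : x ^+ 2 <= h x0 ^+ 2 * (l + 1) / (m * (2 * beta0) ^+ 2).
    have := sqr_ge0 (x - 1); have := sqr_ge0 x; rewrite sqrrB1.
    by move: (x ^+ 2) (_ / _) => y z; lra.
  have mb0 : 0 < m * (2 * beta0) ^+ 2 by rewrite mulr_gt0 // exprn_gt0 // mulr_gt0.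
  rewrite ler_pdivlMr //.
  apply: (@le_trans _ _ (gram x0 (v *m Nf e) * phi (p + x0) e ^+ 2)).
    rewrite mulrCA mulrA; apply: ler_pM.
    - by rewrite mulr_ge0 ?sqr_ge0 // ltW.
    - by rewrite sqr_ge0.
    - exact: mP.
    - by rewrite ler_pXn2r ?nnegrE ?ltW // mulr_gt0.
  by rewrite gE ler_pM2l ?exprn_gt0 // -expr2 in le_l *; exact: ltW.
have [B BP] := choice (fun i : 'I_n.+1 => bound (delta_mx 0 i)).
pose K := [set r : 'rV[R]_(n.+1 * n.+1) | `|r| <= \sum_i `|B i|].
have Kc : compact K.
  apply: bounded_closed_compact.
    by exists (\sum_i `|B i|); split=> [|t t1 r /= rB]; [exact: num_real | exact: le_trans rB (ltW t1)].
  have -> : K = (fun r : 'rV[R]_(n.+1 * n.+1) => `|r|) @^-1` [set t | t <= \sum_i `|B i|] by [].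
  apply: preimage_closed; first by move=> r _; apply: norm_continuous.
  exact: closed_le.
pose F := (fun e => mxvec (Nf e)) @ 0^'+.
have FF : ProperFilter F by exact: fmap_proper_filter.
have FK : F K.
  have /filter_forall allB := BP.
  apply: filterS allB => e eB; apply: rV_norm_le; first by rewrite sumr_ge0.
  move=> k; case/mxvec_indexP: k => i j; rewrite mxvecE.
  have -> : Nf e i j = (delta_mx (0 : 'I_1) i *m Nf e) 0 j.
    by have /rowP/(_ j) := rowE i (Nf e); rewrite mxE.
  apply: le_trans (rV_coord_le _ _) _; apply: le_trans (eB i) _.
  rewrite (bigD1 i) //=; apply: le_trans (ler_norm _) _.
  by rewrite lerDl sumr_ge0.
have [r [_ Fr]] := Kc F FF FK.
exists (vec_mx r); split.
  move=> v; pose g (r : 'rV[R]_(n.+1 * n.+1)) := h (v *m vec_mx r).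
  have gr : {for r, continuous g}.
    by apply: (@qf_cvg _ _ T _ (nbhs r)); apply: (@mulmx_vec_cvg _ _ _ _ _ (nbhs r)); apply: cvg_id.
  have gF : g @ F --> h x0 * phi v 0 / (4 * beta0).
    have [lphi _ _] := limR (p + x0); have [lphiv _ _] := limR v.
    rewrite phi_px0 in lphi.
    have : (fun e => h x0 * phi v e / phi (p + x0) e) @ 0^'+ --> h x0 * phi v 0 / (4 * beta0).
      have b40 : 4 * beta0 != 0 by rewrite mulf_neq0 // gt_eqF.
      exact: (cvgM (cvgM (cvg_cst _) lphiv) (cvgV b40 lphi)).
    apply: cvg_trans.
    apply: (@near_eq_cvg _ _ 0^'+ _ (fun e => h x0 * phi v e / phi (p + x0) e)
      (fun e => g (mxvec (Nf e)))).
    apply: filterS near_N => e [e0 pe].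
    have pe0 : 0 < phi (p + x0) e by apply: lt_trans pe; rewrite mulr_gt0.
    have [hE _ _] := NfP e e0 pe0.
    by rewrite /g /= mxvecK -hE mulfK // gt_eqF.
  have gE := cluster_cvg_eq _ Fr gr gF; rewrite -[h (v *m vec_mx r)]/(g r) gE.
  by rewrite divfK // mulf_neq0 // gt_eqF.
apply: closed_closure => D rD.
have lim : (fun u : 'rV[R]_(n.+1 * n.+1) => x0 *m vec_mx u) @ r --> x0 *m vec_mx r.
  by apply: (@mulmx_vec_cvg _ _ _ _ _ (nbhs r)); apply: cvg_id.
have FC : F [set u | closure C (x0 *m vec_mx u)].
  apply: filterS near_N => e [e0 pe] /=; rewrite mxvecK.
  by case: (NfP e e0 _) => //; apply: lt_trans pe; rewrite mulr_gt0.
by have [u [Cu Du]] := Fr _ _ FC (lim D rD); exists (x0 *m vec_mx u).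
Qed.

Lemma singular_limit : exists q, [/\ closure C q, q != 0, h q = 0 & forall v, T q q q v = 0].
Proof.
have b0 : 0 < beta0 by exact: touching_transversal.
have h0 := Cpos Cx0.
have [N [hN CN]] := blowup_limit.
have phiL x v t : phi (x + t *: v) 0 =
    4 * ((ac x + t * ac v) ^+ 3 * ((bc x + t * bc v) * beta0)) +
    6 * ((ac x + t * ac v) ^+ 2 * T p p (wc x + t *: wc v) (wc x + t *: wc v)).
  by rewrite phi_0 acL bcL wcL.
have b40 : 4 * beta0 != 0 by rewrite mulf_neq0 // gt_eqF.
have coefs x v c0 c1 c2 c3 c4 : (forall t, phi (x + t *: v) 0 =
      c0 + c1 * t + c2 * t ^+ 2 + c3 * t ^+ 3 + c4 * t ^+ 4) ->
    h (x *m N) * (4 * beta0) = h x0 * c0 /\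
    4 * T (x *m N) (x *m N) (x *m N) (v *m N) * (4 * beta0) = h x0 * c1.
  move=> phiE; pose y := x *m N; pose z := v *m N.
  have [t _|-> -> //] := @quartic_coef R (h y * (4 * beta0)) (4 * T y y y z * (4 * beta0))
    (6 * T y y z z * (4 * beta0)) (4 * T y z z z * (4 * beta0)) (h z * (4 * beta0))
    (h x0 * c0) (h x0 * c1) (h x0 * c2) (h x0 * c3) (h x0 * c4).
  have := hN (x + t *: v); rewrite phiE mulmxDl -scalemxAl qf_along -/y -/z.
  by move=> e; transitivity (h x0 * (c0 + c1 * t + c2 * t ^+ 2 + c3 * t ^+ 3 + c4 * t ^+ 4));
    [rewrite -e|]; ring.
have inj v : v *m N = 0 -> v = 0.
  move=> vN; have alw := wc_al v; have betaw := wc_beta v.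
  have phi_const t : phi (p + x0 + t *: v) 0 = 4 * beta0.
    have h0n : h x0 != 0 by rewrite gt_eqF.
    apply: (mulfI h0n).
    by rewrite -hN mulmxDl -scalemxAl vN scaler0 addr0 hN phi_px0.
  have phi_poly t : 4 * ((1 + t * ac v) ^+ 3 * ((1 + t * bc v) * beta0)) +
      6 * ((1 + t * ac v) ^+ 2 * (t ^+ 2 * T p p (wc v) (wc v))) = 4 * beta0.
    rewrite -(phi_const t) phiL px0E acL bcL wcL ac_p ac_x0 bc_p bc_x0 wc_p wc_x0.
    by rewrite !(scaler0, mulr0, mulr1, addr0, add0r) !qfZ; ring.
  have [ab0 w2] : ac v * 3 + bc v = 0 /\ 
      6 * T p p (wc v) (wc v) + 4 * beta0 * (3 * ac v ^+ 2 + 3 * ac v * bc v) = 0.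
    move: (ac v) (bc v) (T p p (wc v) (wc v)) phi_poly => a b w phi_poly.
    have [t _|_ e1 e2 _ _] := @quartic_coef R (4 * beta0) (4 * beta0 * (a * 3 + b))
      (6 * w + 4 * beta0 * (3 * a ^+ 2 + 3 * a * b))
      (4 * beta0 * (a ^+ 3 + 3 * a ^+ 2 * b) + 12 * a * w)
      (4 * beta0 * a ^+ 3 * b + 6 * a ^+ 2 * w) (4 * beta0) 0 0 0 0.
      by rewrite -[in RHS](phi_poly t); ring.
    by split=> //; apply: (mulfI b40); rewrite e1 mulr0.
  have bcE : bc v = - 3 * ac v by lra.
  have w_ge0 : 0 <= T p p (wc v) (wc v).
    have := mulr_ge0 (ltW b0) (sqr_ge0 (ac v)).
    by move: w2; rewrite bcE; lra.
  have wc0 : wc v = 0 by rewrite (touching_tangent betaw w_ge0) alw mul0r scale0r.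
  have ac0 : ac v = 0.
    have : beta0 * ac v ^+ 2 = 0 by move: w2; rewrite wc0 qf04 bcE; lra.
    by move=> /eqP; rewrite mulf_eq0 gt_eqF //= expf_eq0 => /eqP.
  have := erefl (wc v); rewrite {1}/wc wc0 ac0 bcE ac0 mulr0 !scale0r !subr0.
  by [].
exists (x0 *m N); have [hx0N gradN] : h (x0 *m N) = 0 /\
    forall v, T (x0 *m N) (x0 *m N) (x0 *m N) (v *m N) = 0.
  have phiE v t : phi (x0 + t *: v) 0 = 0 + 0 * t + 0 * t ^+ 2 +
      (4 * beta0 * ac v ^+ 3) * t ^+ 3 +
      (4 * beta0 * ac v ^+ 3 * bc v + 6 * ac v ^+ 2 * T p p (wc v) (wc v)) * t ^+ 4.
    by rewrite phiL ac_x0 bc_x0 wc_x0 !add0r !qfZ; ring.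
  split=> [|v].
    have [e _] := coefs _ _ _ _ _ _ _ (phiE 0).
    by apply: (mulIf b40); rewrite e mulr0 mul0r.
  have [_ e] := coefs _ _ _ _ _ _ _ (phiE v).
  have four0 : (4 : R) != 0 by [].
  by apply: (mulfI four0); apply: (mulIf b40); rewrite e !mulr0 mul0r.
have Nu : N \in unitmx by rewrite -row_free_unit; apply: inj_row_free.
split=> //.
  apply/eqP => /inj x00; have := Cpos Cx0; by rewrite x00 qf04 ltxx.
by move=> v; rewrite -[v](mulmxKV Nu) gradN.
Qed.

End HomogeneousCone.

Lemma homogeneous_cone_singular (R : realType) (n : nat) (T : quartic_form R n.+1)
    (C : set 'rV[R]_n.+1) :
  (1 <= n)%N -> C !=set0 -> open C -> (forall t x, 0 < t -> C x -> C (t *: x)) ->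
  (forall x, C x -> 0 < T x x x x) ->
  (forall x v, C x -> T x x x v = 0 -> v != 0 -> T x x v v < 0) ->
  (forall x y, C x -> C y -> T x x x x = T y y y y -> exists A,
    [/\ A \in unitmx, x *m A = y, forall z, C (z *m A) <-> C z &
        forall z, T (z *m A) (z *m A) (z *m A) (z *m A) = T z z z z]) ->
  exists q, [/\ closure C q, q != 0, T q q q q = 0 & forall v, T q q q v = 0].
Proof.
move=> n1 [x0 Cx0] Copen Ccone Cpos Clor Chom.
have [p [Vp p0 pmax]] := touching_point Ccone Cpos Clor Cx0.
have [[u pu]|no] := pselect (exists u, 0 < T p p p u).
  exact: (singular_limit Copen Ccone Cpos Clor Chom Cx0 n1 Vp p0 pmax pu).
exists p; split=> //.
- exact: closure_visible_C Vp.
- exact: (touching_h Copen Ccone Cpos Clor Chom Cx0 n1 Vp p0 pmax).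
move=> v; apply/eqP; rewrite eq_le; apply/andP; split; rewrite leNgt; apply/negP => pv.
  by apply: no; exists v.
by apply: no; exists (- v); rewrite qfN4 oppr_gt0.
Qed.

(** * The cone over a hypersurface is open *)

Section OpenCone.
Context {R : realType} {n : nat}.
Implicit Types (f : 'rV[R]_n.+1 -> R) (p v w x : 'rV[R]_n.+1).

Lemma differential_sign f p w (c : R) : differentiable f p -> f p = 0 ->
  0 < c * 'd f p w -> exists2 d, 0 < d & forall t, 0 < t < d -> 0 < c * f (p + t *: w).
Proof.
move=> df fp0 cpos.
have lim : (fun h => c * (h^-1 *: ((f \o shift p) (h *: w) - f p))) @ (0 : R)^' --> c * 'd f p w.
  apply: (cvgM (cvg_cst _)); rewrite -(deriveE w df); exact: diff_derivable df.
have near_pos : \forall h \near (0 : R), h != 0 ->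
    0 < c * (h^-1 *: ((f \o shift p) (h *: w) - f p)).
  exact: (cvgr_gt _ lim _ cpos).
have /nbhs_ballP[d d0 dP] := near_pos.
exists d => // t /andP[t0 td].
have := dP t; rewrite /ball /= sub0r normrN gtr0_norm // gt_eqF // => /(_ td isT).
rewrite fp0 subr0 addrC -[_ *: f _]/(_ * _) mulrCA pmulr_rgt0 ?invr_gt0 //.
Qed.

Lemma segment_IVT f p v (a b : R) : a <= b ->
  (forall t, a <= t <= b -> {for p + t *: v, continuous f}) ->
  Num.min (f (p + a *: v)) (f (p + b *: v)) <= 0 <= Num.max (f (p + a *: v)) (f (p + b *: v)) ->
  exists2 t, a <= t <= b & f (p + t *: v) = 0.
Proof.
move=> ab fc sgn; have [|t tab ft] := @IVT R (fun t => f (p + t *: v)) a b 0 ab _ sgn.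
  apply: continuous_in_subspaceT => t; rewrite inE /= in_itv /= => tab.
  apply: (@continuous_comp _ _ _ (fun t : R => p + t *: v) f).
    by apply: (@cvg_along _ _ _ (nbhs t)); apply: cvg_id.
  exact: fc.
by exists t => //; rewrite in_itv in tab.
Qed.

Lemma cone_overZ (H : set 'rV[R]_n.+1) t x : 0 < t -> cone_over H x -> cone_over H (t *: x).
Proof.
move=> t0 [s [y [s0 Hy ->]]]; exists (t * s), y.
by rewrite mulr_gt0 // scalerA.
Qed.

Lemma hypersurface_transversal (T : quartic_form R n.+1) (U : set 'rV[R]_n.+1) f p v :
  open U -> U p -> (forall x, U x -> differentiable f x) ->
  (forall x, U x -> f x = 0 -> T x x x x = 1) -> f p = 0 -> 0 < 'd f p v -> 'd f p p != 0.
Proof.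
move=> Uo Up fdiff fT fp dv; apply/eqP => dp.
pose M := 32 * `|T p p p v| + 24 * `|T p p v v| + 8 * `|T p v v v| + `|T v v v v|.
have M0 : 0 <= M by rewrite !addr_ge0 // mulr_ge0.
pose e := (M + 1)^-1.
have e0 : 0 < e by rewrite invr_gt0 ltr_wpDl.
have dlin (c : R) : 'd f p (p + c *: v) = c * 'd f p v.
  by rewrite linearD linearZ /= dp add0r.
have [d1 d10 d1P] : exists2 d, 0 < d & forall t, 0 < t < d -> 0 < 1 * f (p + t *: (p + e *: v)).
  by apply: differential_sign => //; [exact: fdiff | rewrite mul1r dlin mulr_gt0].
have [d2 d20 d2P] : exists2 d, 0 < d & forall t, 0 < t < d -> 0 < -1 * f (p + t *: (p + (- e) *: v)).
  by apply: differential_sign => //; [exact: fdiff | rewrite dlin mulN1r mulNr opprK mulr_gt0].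
have /nbhs_ballP[r r0 rP] : nbhs p U by exact: open_nbhs_nbhs.
pose K := `|p| + e * `|v| + 1.
have K0 : 0 < K by rewrite ltr_wpDl // addr_ge0 // mulr_ge0 // ltW.
pose t := Num.min (Num.min d1 d2) (Num.min 1 (r / K)) / 2.
have t0 : 0 < t by rewrite !divr_gt0 // !lt_min d10 d20 ltr01 divr_gt0.
have t_min : t < Num.min (Num.min d1 d2) (Num.min 1 (r / K)).
  by rewrite /t ltr_pdivrMr // ltr_pMr ?ltr1n // !lt_min d10 d20 ltr01 divr_gt0.
move: t_min; rewrite !lt_min => /andP[/andP[td1 td2] /andP[t1 tr]].
have inU s : - e <= s <= e -> U ((p + t *: p) + (t * s) *: v).
  move=> /andP[se es]; apply: rP; rewrite -ball_normE /ball_ /=.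
  have -> : p - (p + t *: p + (t * s) *: v) = - (t *: (p + s *: v)).
    by apply/rowP => i; rewrite !mxE; ring.
  rewrite normrN normrZ gtr0_norm //.
  apply: (@le_lt_trans _ _ (t * K)); last by rewrite -ltr_pdivlMr.
  rewrite ler_wpM2l ?(ltW t0) //; apply: le_trans (ler_normD _ _) _.
  rewrite normrZ /K -addrA lerD2l; have : `|s| * `|v| <= e * `|v|.
    by rewrite ler_wpM2r // ler_norml se es.
  by move=> *; lra.
have [|||s se fs] := @segment_IVT f (p + t *: p) (t *: v) (- e) e.
- by lra.
- move=> s /inU; rewrite scalerA [s * t]mulrC => Us.
  exact: (differentiable_continuous (fdiff _ Us)).
- have shiftE s : p + t *: (p + s *: v) = p + t *: p + s *: (t *: v).
    by apply/rowP => i; rewrite !mxE; ring.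
  have := d1P t; rewrite t0 td1 shiftE mul1r => /(_ isT) f1.
  have := d2P t; rewrite t0 td2 shiftE mulN1r oppr_gt0 => /(_ isT) f2.
  by rewrite ge_min le_max (ltW f1) (ltW f2) orbT.
have Us := inU s se; have := fT _ Us.
have [a aE] : exists a, a = t * s by exists (t * s).
have -> : p + t *: p + (t * s) *: v = (1 + t) *: p + a *: v.
  by rewrite aE scalerDl scale1r.
have -> : f ((1 + t) *: p + a *: v) = 0.
  by rewrite -fs aE scalerA [s * t]mulrC scalerDl scale1r.
move=> /(_ erefl); rewrite qf_along !qfZ => h1.
have a_le : `|a| <= t * e by rewrite aE normrM gtr0_norm // ler_wpM2l ?(ltW t0) // ler_norml.
have e1 : e <= 1 by rewrite invf_le1 ?ltr_wpDl // lerDr.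
have a1 : `|a| <= 1.
  by apply: le_trans a_le _; rewrite -[leRHS]mulr1 ler_pM ?(ltW t0) ?(ltW e0) ?(ltW t1).
pose X := 4 * (1 + t) ^+ 3 * T p p p v + 6 * a * (1 + t) ^+ 2 * T p p v v +
  4 * a ^+ 2 * (1 + t) * T p v v v + a ^+ 3 * T v v v v.
have hX : (1 + t) ^+ 4 + a * X = 1.
  by rewrite -[RHS]h1 (fT p Up fp) /X; ring.
have t2 k : (1 + t) ^+ k <= 2 ^+ k.
  by apply: lerXn2r; rewrite ?nnegrE; lra.
have t2p k : 0 <= (1 + t) ^+ k by rewrite exprn_ge0 // addr_ge0 // ltW.
have ak k : `|a| ^+ k <= 1 by exact: exprn_ile1.
have XM : `|X| <= M.
  rewrite /X /M; apply: le_trans (ler_normD _ _) _; apply: lerD; last first.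
    by rewrite normrM normrX ler_piMl.
  apply: le_trans (ler_normD _ _) _; apply: lerD; last first.
    rewrite normrM ler_wpM2r // (normrM _ (1 + t)) (normrM 4) normrX.
    rewrite (ger0_norm (ler0n R 4)) (ger0_norm (t2p 1%N : 0 <= 1 + t)).
    have := ler_pM (exprn_ge0 2 (normr_ge0 a)) (t2p 1%N) (ak 2) (t2 1%N).
    by rewrite !expr1; lra.
  apply: le_trans (ler_normD _ _) _; apply: lerD; rewrite normrM ler_wpM2r //.
    by rewrite normrM (ger0_norm (ler0n R 4)) (ger0_norm (t2p 3)); have := t2 3; lra.
  rewrite (normrM _ ((1 + t) ^+ 2)) (normrM 6) (ger0_norm (ler0n R 6)) (ger0_norm (t2p 2)).
  by have := ler_pM (normr_ge0 a) (t2p 2) a1 (t2 2); lra.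
have aX : `|a * X| <= t.
  rewrite normrM; apply: (@le_trans _ _ (t * e * M)).
    exact: ler_pM.
  rewrite -mulrA -[leRHS]mulr1 ler_wpM2l ?(ltW t0) // mulrC ler_pdivrMr ?ltr_wpDl //.
  by rewrite mul1r lerDl.
have := ler_norm (- (a * X)); rewrite normrN.
have t4 : (1 + t) ^+ 4 = 1 + 4 * t + t ^+ 2 * (6 + 4 * t + t ^+ 2) by ring.
have : 0 <= t ^+ 2 * (6 + 4 * t + t ^+ 2).
  by rewrite mulr_ge0 ?sqr_ge0 // !addr_ge0 ?sqr_ge0 // mulr_ge0 // ltW.
by move: hX aX; rewrite t4; lra.
Qed.

Lemma cone_over_open (T : quartic_form R n.+1) (H : set 'rV[R]_n.+1) :
  hypersurface H -> (forall x, H x -> T x x x x = 1) -> open (cone_over H).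
Proof.
move=> [_ Hloc] HT.
suff nearH p : H p -> nbhs p (cone_over H).
  rewrite openE => x [t [p [t0 Hp ->]]]; rewrite /interior.
  have lim (q : 'rV[R]_n.+1) : (fun y => 0 + t^-1 *: y) @ q --> 0 + t^-1 *: q.
    by apply: (@cvg_affine _ _ _ (nbhs q)); apply: cvg_id.
  have := lim (t *: p) (cone_over H); rewrite add0r scalerA mulVf ?gt_eqF // scale1r.
  move=> /(_ (nearH p Hp)) near_H.
  apply: (@filterS _ (nbhs (t *: p)) _ _ _ _ near_H) => y; rewrite /= add0r => Hy.
  have t_neq0 : t != 0 by rewrite gt_eqF.
  by rewrite -[y]scale1r -(mulfV t_neq0) -scalerA; apply: cone_overZ.
move=> Hp; have [U [f [[Uo Up] fsm fdn0 HU]]] := Hloc p Hp.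
have fdiff x : U x -> differentiable f x by have [+ _] := fsm 1%N; apply.
have fp : f p = 0.
  by have : (H `&` U) p by []; rewrite HU => -[].
have fT x : U x -> f x = 0 -> T x x x x = 1.
  by move=> Ux fx; apply: HT; suff [] : (H `&` U) x by []; rewrite HU.
have dp : 'd f p p != 0.
  have [v dv] := fdn0 p Up.
  have [dv0|dv0] := ltP 0 ('d f p v).
    exact: (hypersurface_transversal Uo Up fdiff fT fp dv0).
  apply: (hypersurface_transversal (v := - v) Uo Up fdiff fT fp).
  by rewrite linearN /= oppr_gt0 lt_neqAle dv.
pose c := 'd f p p.
have cc : 0 < c * c by rewrite -expr2 exprn_even_gt0.
have [d1 d10 d1P] := @differential_sign f p p c (fdiff p Up) fp cc.
have [d2 d20 d2P] : exists2 d, 0 < d & forall t, 0 < t < d -> 0 < - c * f (p + t *: (- p)).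
  by apply: differential_sign => //; [exact: fdiff | rewrite linearN /= mulrNN].
have /nbhs_ballP[r r0 rP] : nbhs p U by exact: open_nbhs_nbhs.
pose K := `|p| + 1.
have K0 : 0 < K by rewrite ltr_wpDl.
pose m := Num.min (Num.min d1 d2) (Num.min 1 (r / K)).
have m0 : 0 < m by rewrite !lt_min d10 d20 ltr01 divr_gt0.
pose t := m / 2.
have t0 : 0 < t by rewrite divr_gt0.
have : t < m by rewrite ltr_pdivrMr // ltr_pMr // ltr1n.
rewrite !lt_min => /andP[/andP[td1 td2] /andP[t1 tr]].
have inU x s : `|p - x| < t / 2 -> - t <= s <= t -> U (x + s *: x).
  move=> px /andP[ts st]; apply: rP; rewrite -ball_normE /ball_ /=.
  have -> : p - (x + s *: x) = (1 + s) *: (p - x) - s *: p.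
    by apply/rowP => i; rewrite !mxE; ring.
  apply: le_lt_trans (ler_normB _ _) _; rewrite !normrZ.
  apply: (@le_lt_trans _ _ (2 * (t / 2) + t * `|p|)).
    apply: lerD; apply: ler_pM => //; [| exact: ltW |]; rewrite ler_norml; apply/andP; split; lra.
  apply: (@le_lt_trans _ _ (t * K)); last by rewrite -ltr_pdivlMr.
  by rewrite /K; lra.
have fcont x s : `|p - x| < t / 2 -> - t <= s <= t -> {for x + s *: x, continuous f}.
  by move=> px ts; apply/differentiable_continuous/fdiff/inU.
have pp : `|p - p| < t / 2 by rewrite subrr normr0 divr_gt0.
have near_sign (k s : R) : - t <= s <= t -> 0 < k * f (p + s *: p) ->
    \forall x \near p, 0 < k * f (x + s *: x).
  move=> ts pos.
  have lim : (fun x => k * f (x + s *: x)) @ p --> k * f (p + s *: p).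
    apply: (@cvgM _ _ (nbhs p)); first by apply: cvg_cst.
    apply: (@continuous_comp _ _ _ (fun x : 'rV[R]_n.+1 => x + s *: x) f); last exact: fcont.
    by apply: (@cvgD _ _ _ (nbhs p)); [apply: cvg_id | apply: (@cvgZ _ _ _ (nbhs p));
      [apply: cvg_cst | apply: cvg_id]].
  exact: (cvgr_gt _ lim _ pos).
have near1 : \forall x \near p, 0 < c * f (x + t *: x).
  by apply: near_sign; [apply/andP; split; lra | apply: d1P; rewrite t0].
have near2 : \forall x \near p, 0 < - c * f (x + (- t) *: x).
  apply: near_sign; first by apply/andP; split; lra.
  by rewrite scaleNr -scalerN; apply: d2P; rewrite t0.
have near3 : \forall x \near p, `|p - x| < t / 2.
  have t20 : 0 < t / 2 by rewrite divr_gt0.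
  by have := nbhsx_ballx p _ t20; rewrite -ball_normE.
apply: filterS3 near1 near2 near3 => x f1 f2 px.
have [|||s st fs] := @segment_IVT f x x (- t) t.
- by lra.
- by move=> s; exact: fcont.
- have [c0|c0|c0] := ltgtP c 0.
  + move: f1 f2; rewrite nmulr_rgt0 // pmulr_rgt0 ?oppr_gt0 // => f1 f2.
    by rewrite ge_min le_max (ltW f1) (ltW f2) orbT.
  + move: f1 f2; rewrite pmulr_rgt0 // nmulr_rgt0 ?oppr_lt0 // => f1 f2.
    by rewrite ge_min le_max (ltW f1) (ltW f2) orbT.
  + by move: cc; rewrite c0 mul0r ltxx.
have s1 : 0 < 1 + s by case/andP: st => *; lra.
have Hs : H (x + s *: x).
  have : (H `&` U) (x + s *: x) by rewrite HU; split=> //; apply: inU.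
  by case.
exists (1 + s)^-1, (x + s *: x); split=> //; first by rewrite invr_gt0.
by rewrite -[x in RHS]scale1r scalerA mulr1 -scalerDl scalerA mulVf ?scale1r // gt_eqF.
Qed.

End OpenCone.

(** * Quartic GPSR manifolds *)

Section ConeOver.
Context {R : realType} {n : nat} (h : mpoly n.+1 R) (H : set 'rV[R]_n.+1).
Hypothesis h4 : h \is ishomog1 4 mdeg.
Local Notation T := (polar_form h).
Implicit Types (u v x y z : 'rV[R]_n.+1).

Lemma polar_form_diag x : T x x x x = poly_at h x.
Proof. exact: polar_diag. Qed.

Lemma hyperbolic_polar x v : hyperbolic_point h x -> 0 < poly_at h x ->
  T x x x v = 0 -> v != 0 -> T x x v v < 0.
Proof.
move=> hyp hx xv v0.
have form u w : (u *m (- hessian_at h x) *m w^T) 0 0 = - (12 * T x x u w).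
  rewrite mulmxN mulNmx mxE polar_hess //; congr (- _).
  rewrite -mulmxA mxE; apply: eq_bigr => i _; rewrite mxE mulr_sumr.
  by apply: eq_bigr => j _; rewrite [w^T _ _]mxE; ring.
have sym : (- hessian_at h x)^T = - hessian_at h x.
  by apply/matrixP => i j; rewrite !mxE mderiv_comm.
have := lorentzian_pos_orthogonal (x := x) (v := v) sym hyp.
rewrite !form polar_form_diag xv mulr0 oppr0.
rewrite oppr_lt0 !pmulr_rgt0 // oppr_gt0 pmulr_rlt0 //.
by apply.
Qed.

Hypothesis H1 : forall x, H x -> poly_at h x = 1.

Lemma cone_over_pos x : cone_over H x -> 0 < T x x x x.
Proof.
move=> [t [y [t0 Hy ->]]].
by rewrite qf_scale polar_form_diag H1 // mulr1 exprn_gt0.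
Qed.

Lemma symmetry_cone A z : linear_symmetry H A -> cone_over H (z *m A) <-> cone_over H z.
Proof.
move=> [Au HA]; split=> -[s [w [s0 Hw zE]]].
  have [y Hy yA] : [set x *m A | x in H] w by rewrite HA.
  exists s, y; split=> //.
  by move: zE => /(congr1 (mulmx^~ (invmx A))); rewrite -yA scalemxAl !mulmxK.
exists s, (w *m A); split=> //; last by rewrite zE scalemxAl.
by have : [set x *m A | x in H] (w *m A) by [exists w]; rewrite HA.
Qed.

Lemma symmetry_h A : open (cone_over H) -> H !=set0 -> linear_symmetry H A ->
  forall z, T (z *m A) (z *m A) (z *m A) (z *m A) = T z z z z.
Proof.
move=> Co [x0 Hx0] HA z; have [Au HAH] := HA.
have hC x : cone_over H x -> T (x *m A) (x *m A) (x *m A) (x *m A) = T x x x x.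
  move=> [t [y [t0 Hy ->]]]; rewrite -scalemxAl !qf_scale !polar_form_diag !H1 //.
  by have : [set x *m A | x in H] (y *m A) by [exists y]; rewrite HAH.
have Cx0 : cone_over H x0 by exists 1, x0; rewrite scale1r.
by apply: (qf_invariant_near (x0 := x0) _ hC); apply: open_nbhs_nbhs.
Qed.

Lemma cone_over_homogeneous x y : open (cone_over H) -> homogeneous_hypersurface H ->
  cone_over H x -> cone_over H y -> T x x x x = T y y y y -> exists A,
    [/\ A \in unitmx, x *m A = y, forall z, cone_over H (z *m A) <-> cone_over H z &
        forall z, T (z *m A) (z *m A) (z *m A) (z *m A) = T z z z z].
Proof.
move=> Co Hom [s [p [s0 Hp ->]]] [t [q [t0 Hq ->]]].
rewrite !qf_scale !polar_form_diag !H1 // !mulr1 => /eqP.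
rewrite eqrXn2 ?ltW // => /eqP ->.
have [A HA pA] := Hom p q Hp Hq; exists A; split.
- by case: HA.
- by rewrite -scalemxAl pA.
- by move=> z; apply: symmetry_cone.
- by apply: symmetry_h => //; exists p.
Qed.

End ConeOver.

Theorem proposition4p1 (R : realType) (n : nat) (hn : (1 <= n)%N)
    (h : mpoly.mpoly n.+1 R) (H : set 'rV[R]_n.+1) :
  quartic_GPSR h H -> homogeneous_hypersurface H -> singular_at_infinity h H.
Proof.
move=> [h4 _ Hs H1 Hhyp] Hom.
have Co : open (cone_over H).
  by apply: (cone_over_open (T := polar_form h) Hs) => x Hx; rewrite polar_form_diag // H1.
have C0 : cone_over H !=set0.
  by have [[x Hx] _] := Hs; exists x, 1, x; rewrite scale1r.
have [||||q [Cq q0 hq dq]] := homogeneous_cone_singular (T := polar_form h) hn C0 Co.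
- by move=> t x; exact: cone_overZ.
- exact: cone_over_pos.
- move=> x v [t [y [t0 Hy ->]]]; rewrite !qfZ => yv v0.
  rewrite !(pmulr_rlt0 _ t0); apply: hyperbolic_polar => //; [exact: Hhyp | by rewrite H1 |].
  have tn0 : t != 0 by rewrite gt_eqF.
  by apply/(mulfI tn0)/(mulfI tn0)/(mulfI tn0); rewrite yv !mulr0.
- by move=> x y; exact: cone_over_homogeneous.
have grad0 : gradient_at h q = 0.
  apply/rowP => i; rewrite [RHS]mxE.
  have := polar_grad h4 q (delta_mx 0 i).
  rewrite [polar _ _ _ _ _](dq (delta_mx 0 i)) mulr0.
  rewrite (bigD1 i) //= big1 => [|j ji]; first by rewrite mxE !eqxx mul1r addr0 => <-.
  by rewrite mxE (negPf ji) andbF mul0r.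
have hq0 : poly_at h q = 0 by rewrite -(polar_form_diag h4).
have notC : ~ interior (cone_over H) q.
  by move=> /interior_subset Cq'; have := cone_over_pos h4 H1 Cq'; rewrite hq ltxx.
by exists q; split; [split; [exact: Cq | exact: notC] | exact: q0 | exact: hq0 | exact: grad0].
Qed.
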